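(* Let $\mathbb{X}$ be a Polish space and $c:\mathbb{X}\times\mathbb{X}\to\mathbb{R}\cup\{+\infty\}$ a debiasable cost. Let $(\mathcal{Z},\psi)$ be an inf-representation of $c$, i.e. $c(x,y)=\inf_{z\in\mathcal{Z}}\psi(x,z)+\psi(y,z)$ for all $x,y\in\mathbb{X}$, and assume that $\mathcal{Z}$ is also a Polish space and $\psi:\mathbb{X}\times\mathcal{Z}\to\mathbb{R}\cup\{+\infty\}$ is measurable. Let $\lambda\in\mathcal{M}_+(\mathcal{Z})$ and $\varepsilon>0$ be such that $\int_{\mathcal{Z}}e^{-2\psi(x,z)/\varepsilon}\,d\lambda(z)<+\infty$ for all $x\in\mathbb{X}$, and define $$c_{\varepsilon,\lambda}(x,y):=-\varepsilon\log\int_{\mathcal{Z}}e^{-\frac{\psi(x,z)+\psi(y,z)}{\varepsilon}}\,d\lambda(z).$$ Then the entropic optimal transport cost $\mathrm{OT}^\varepsilon_{c_{\varepsilon,\lambda}}$ (and likewise its unbalanced version $\mathrm{UOT}^\varepsilon_{c_{\varepsilon,\lambda},F}$, for any Csiszár divergence $F$) is debiasable. Moreover, for all $\mu,\nu\in\mathcal{P}(\mathbb{X})$, $$\mathrm{OT}^\varepsilon_{c_{\varepsilon,\lambda}}(\mu,\nu)=\inf_{\eta\in\mathcal{P}(\mathcal{Z})}\mathrm{OT}^\varepsilon_\psi(\mu,\eta)+\mathrm{OT}^\varepsilon_\psi(\nu,\eta)+\varepsilon\,\mathrm{KL}(\eta|\lambda).$$ In addition, if $\lambda\in\mathcal{P}(\mathcal{Z})$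 is a probability measure, then $\mathrm{OT}^\varepsilon_{c_{\varepsilon,\lambda}}\ge\mathrm{OT}^\varepsilon_c$.
   Context: A symmetric function $C:\mathcal{X}\times\mathcal{X}\to\mathbb{R}\cup\{+\infty\}$ is debiasable if $C(x,y)-\tfrac12C(x,x)-\tfrac12C(y,y)\ge0$ for all $x,y\in\mathcal{X}$, with the rule $\infty-\infty=+\infty$. $\mathcal{P}$: Borel probability measures; $\mathcal{M}_+$: finite nonnegative Borel measures; $\Pi(\mu,\eta)$: couplings; $p_i$: projections. $\mathrm{KL}(\mu|\nu)=\int\log\frac{d\mu}{d\nu}\,d\mu$ if $\mu\ll\nu$, $+\infty$ otherwise. For a measurable $b$ on $\mathbb{X}\times\mathbb{Y}$ ($\mathbb{Y}=\mathbb{X}$ or $\mathcal{Z}$), $\mu\in\mathcal{P}(\mathbb{X})$, $\eta\in\mathcal{P}(\mathbb{Y})$: $$\mathrm{OT}^\varepsilon_b(\mu,\eta)=\inf_{\pi\in\Pi(\mu,\eta)}\int b\,d\pi+\varepsilon\,\mathrm{KL}(\pi|\mu\otimes\eta).$$ For $\mu,\nu\in\mathcal{M}_+(\mathbb{X})$: $\mathrm{UOT}^\varepsilon_{b,F}(\mu,\nu)=\inf_{\pi\in\mathcal{P}(\mathbb{X}\times\mathbb{X})}\int b\,d\pi+F((p_1)_\#\pi,\mu)+F((p_2)_\#\pi,\nu)+\varepsilon\,\mathrm{KL}(\pi|\mu\otimes\nu)$, where a Csiszár divergence is $F(\mu,\nu)=\int h\big(\frac{d\mu}{d\nu}\big)d\nu+h_\infty\int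 d\mu^\perp$ for a convex lower semicontinuous $h:[0,+\infty)\to\mathbb{R}\cup\{+\infty\}$ with $h(1)=0$, $h_\infty=\lim_{r\to+\infty}h(r)/r$, and $\mu^\perp$ the singular part of $\mu$ with respect to $\nu$ ($\frac{d\mu}{d\nu}$ being the density of the absolutely continuous part). All integrals and infima are assumed well defined in $\mathbb{R}\cup\{+\infty\}$. *)

(* Defs.v *)
From HB Require Import structures.
From mathcomp Require Import all_boot all_order all_algebra.
From mathcomp Require Import all_classical all_reals all_analysis.
From mathcomp Require Import measurable_realfun.

Set Implicit Arguments.
Unset Strict Implicit.
Unset Printing Implicit Defensive.

Import Order.TTheory GRing.Theory Num.Theory.
Import numFieldNormedType.Exports.

Local Open Scope classical_set_scope.
Local Open Scope ring_scope.
Local Open Scope ereal_scope.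

(* Separable and homeomorphic to a complete metric space. *)
Definition polish_space (R : realType) (T : topologicalType) : Prop :=
  (exists2 D : set T, countable D & dense D) /\
  exists (M : metricType R) (f : T -> M) (g : M -> T),
    [/\ cancel f g, cancel g f, continuous f, continuous g &
        forall F : set_system M, ProperFilter F -> cauchy F ->
          exists p : M, F --> p].

(* On borel X * borel Y the library puts the product sigma-algebra, which is the
   Borel one when X and Y are second countable. *)
Notation borel X := (g_sigma_algebraType (@open X)).

(* The dual addition of \bar R is the one with oo - oo = +oo. *)
Definition debiasable (R : realType) (T : Type) (C : T -> T -> \bar R) : Prop :=
  [/\ forall x y, C x y != -oo,
      forall x y, C x y = C y x &
      forall x y, (0 <= C x y - 2^-1%:E * C x x - 2^-1%:E * C y y)%dE].

Definition inf_representation (R : realType) (X Z : Type)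
    (c : X -> X -> \bar R) (psi : X -> Z -> \bar R) : Prop :=
  (forall x z, psi x z != -oo) /\
  forall x y, c x y = ereal_inf [set psi x z + psi y z | z in [set: Z]].

Definition soft_cost (R : realType) d (X : Type) (Z : measurableType d)
    (psi : X -> Z -> \bar R) (eps : R)
    (lambda : {finite_measure set Z -> \bar R}) (x y : X) : \bar R :=
  - (eps%:E * lne (\int[lambda]_z expeR (- (eps^-1%:E * (psi x z + psi y z))))).

Definition KL (R : realType) d (T : measurableType d)
    (mu : {finite_measure set T -> \bar R})
    (nu : {finite_measure set T -> \bar R}) : \bar R :=
  if `[< mu `<< nu >] then
    \int[mu]_x lne (Radon_Nikodym (charge_of_finite_measure mu) nu x)
  else +oo.

Section marginals.
Context (R : realType) d1 d2 (X : measurableType d1) (Y : measurableType d2).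

HB.instance Definition _ :=
  isMeasurableFun.Build _ _ (X * Y)%type X fst measurable_fst.
HB.instance Definition _ :=
  isMeasurableFun.Build _ _ (X * Y)%type Y snd measurable_snd.

Definition marginal1 (pi : probability (X * Y)%type R) : probability X R :=
  distribution pi (fst : {mfun (X * Y)%type >-> X}).
Definition marginal2 (pi : probability (X * Y)%type R) : probability Y R :=
  distribution pi (snd : {mfun (X * Y)%type >-> Y}).

End marginals.

(* The library declares mu \x nu finite only for subprobabilities. *)
Section tensor.
Context (R : realType) d1 d2 (X : measurableType d1) (Y : measurableType d2).
Variables (mu : {finite_measure set X -> \bar R})
          (nu : {finite_measure set Y -> \bar R}).

Definition tensor : set (X * Y) -> \bar R := mu \x nu.

HB.instance Definition _ := Measure.copy tensor (mu \x nu).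

Let tensor_fin : fin_num_fun tensor.
Proof.
move=> A mA; rewrite ge0_fin_numE//.
apply: (@le_lt_trans _ _ (tensor setT)); first by apply: le_measure; rewrite ?inE.
rewrite /tensor -setXTT product_measure1E// lte_mul_pinfty//.
  exact: fin_num_measure.
by rewrite -ge0_fin_numE//; exact: fin_num_measure.
Qed.

HB.instance Definition _ := @Measure_isFinite.Build _ _ _ tensor tensor_fin.

End tensor.

Section entropic_transport.
Context (R : realType) d1 d2 (X : measurableType d1) (Y : measurableType d2).
Implicit Types (b : X -> Y -> \bar R) (eps : R).
Implicit Types (mu : probability X R) (eta : probability Y R).

Definition couplings mu eta : set (probability (X * Y)%type R) :=
  [set pi | (forall A, measurable A -> marginal1 pi A = mu A) /\
            (forall B, measurable B -> marginal2 pi B = eta B)].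

Definition OT eps b mu eta : \bar R :=
  ereal_inf [set \int[pi]_p b p.1 p.2 + eps%:E * KL pi (tensor mu eta)
            | pi in couplings mu eta].

(* The integral of b exists in R u {+oo}. Measurability of b is not part of it:
   for a universally measurable b, such as an infimum over a Polish space of a
   Borel function, the library's integral is the one for the completion of pi. *)
Definition integral_well_defined b (pi : probability (X * Y)%type R) : Prop :=
  \int[pi]_p ((fun q => b q.1 q.2)^\- p) < +oo.

Definition OT_well_defined eps b mu eta : Prop :=
  (forall pi, couplings mu eta pi -> integral_well_defined b pi) /\
  OT eps b mu eta != -oo.

End entropic_transport.

Section csiszar_divergence.
Context (R : realType) d (T : measurableType d).

Section lebesgue_decomposition.
Variables mu nu : {finite_measure set T -> \bar R}.

Definition lebesgue_decomposition (f : T -> R)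
    (s : {measure set T -> \bar R}) : Prop :=
  [/\ measurable_fun setT f,
      forall x, (0 <= f x)%R,
      exists N, [/\ measurable N, nu N = 0 & s (~` N) = 0] &
      forall A, measurable A -> mu A = \int[nu]_(x in A) (f x)%:E + s A].

Let rho : set T -> \bar R := measure_add mu nu.

HB.instance Definition _ := Measure.copy rho (measure_add mu nu).

Let rhoE A : rho A = mu A + nu A.
Proof. exact: measure_addE. Qed.

Let rho_fin : fin_num_fun rho.
Proof. by move=> A mA; rewrite rhoE fin_numD !fin_num_measure. Qed.

HB.instance Definition _ := @Measure_isFinite.Build _ _ _ rho rho_fin.

Lemma lebesgue_decomposition_ex :
  exists fs : (T -> R) * {measure set T -> \bar R},
    lebesgue_decomposition fs.1 fs.2.
Proof.
have nurho : nu `<< (rho : {measure set T -> \bar R}).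
  apply/null_content_dominatesP => A mA.
  by rewrite [X in X = 0 -> _]rhoE => /eqP; rewrite padde_eq0// => /andP[_ /eqP].
have [g [g0 ig gE]] := radon_nikodym_finite nurho.
have mg : measurable_fun setT g by apply: measurable_int ig.
pose N := [set x | g x = 0].
have mN : measurable N.
  rewrite (_ : N = setT `&` g @^-1` [set 0]); last by rewrite setTI.
  exact: mg.
have nuN : nu N = 0 by rewrite gE// integral0_eq.
have mNC : measurable (~` N) := measurableC mN.
have dom : (mrestr mu mNC : {measure set T -> \bar R}) `<< nu.
  apply/null_content_dominatesP => A mA nuA.
  have mANC : measurable (A `&` ~` N) by exact: measurableI.
  have : nu (A `&` ~` N) = 0.
    by apply/eqP; rewrite eq_le measure_ge0 andbT -nuA le_measure ?inE.
  rewrite gE// => int0.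
  have : ae_eq rho (A `&` ~` N) g (cst 0).
    apply/ae_eq_integral_abs => //; first exact: measurable_funTS.
    by under eq_integral do rewrite gee0_abs//.
  case=> B [mB rhoB sub].
  rewrite /mrestr; apply/eqP; rewrite eq_le measure_ge0 andbT.
  have muB : mu B = 0.
    move: rhoB; rewrite [X in X = 0 -> _]rhoE => /eqP.
    by rewrite padde_eq0// => /andP[/eqP].
  apply: (@le_trans _ _ (mu B)); last by rewrite muB.
  apply: le_measure; rewrite ?inE//=.
  by move=> x ANx; apply: sub => /= /(_ ANx) gx0; case: ANx => _; apply.
have [f [f0 ffin iF fE]] := radon_nikodym_sigma_finite dom.
exists (fine \o f, (mrestr mu mN : {measure set T -> \bar R})); split => /=.
- by apply: measurableT_comp => //; exact: measurable_int iF.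
- by move=> x; exact: fine_ge0.
- by exists N; split => //; rewrite /mrestr setICl measure0.
- move=> A mA; under eq_integral do rewrite fineK//.
  rewrite -fE// /mrestr/= addeC -measureU//; first last.
  + by rewrite setIACA setICr setI0.
  + exact: measurableI.
  + exact: measurableI.
  by rewrite -setIUr setUv setIT.
Qed.

(* d mu / d nu for the absolutely continuous part of mu; unique nu-a.e. *)
Definition ac_density : T -> R := (sval (cid lebesgue_decomposition_ex)).1.

(* mu^\perp *)
Definition singular_part : {measure set T -> \bar R} :=
  (sval (cid lebesgue_decomposition_ex)).2.

End lebesgue_decomposition.

Definition recession_slope (h : R -> \bar R) : \bar R :=
  lim (h r * (r^-1)%:E @[r --> +oo%R]).

Definition csiszar (h : R -> \bar R)
    (mu nu : {finite_measure set T -> \bar R}) : \bar R :=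
  \int[nu]_x h (ac_density mu nu x) +
  recession_slope h * singular_part mu nu setT.

End csiszar_divergence.

(* Only the values of h on [0, +oo[ matter; semicontinuity on this closed set
   is that of the extension of h by +oo. *)
Definition csiszar_entropy (R : realType) (h : R -> \bar R) : Prop :=
  [/\ forall r, (0 <= r)%R -> h r != -oo,
      h 1%R = 0,
      forall r s t, (0 <= r)%R -> (0 <= s)%R -> (0 <= t <= 1)%R ->
        h (t * r + (1 - t) * s)%R <= t%:E * h r + (1 - t)%:E * h s &
      lower_semicontinuous (patch (cst +oo) [set r | (0 <= r)%R] h)].

Section unbalanced_transport.
Context (R : realType) d (X : measurableType d).
Implicit Types (b : X -> X -> \bar R) (eps : R).
Implicit Types F : {finite_measure set X -> \bar R} ->
                   {finite_measure set X -> \bar R} -> \bar R.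
Implicit Types mu nu : {finite_measure set X -> \bar R}.

Definition UOT eps b F mu nu : \bar R :=
  ereal_inf [set \int[pi]_p b p.1 p.2 + F (marginal1 pi) mu +
                 F (marginal2 pi) nu + eps%:E * KL pi (tensor mu nu)
            | pi in [set: probability (X * X)%type R]].

Definition UOT_well_defined eps b F mu nu : Prop :=
  (forall pi, integral_well_defined b pi) /\ UOT eps b F mu nu != -oo.

End unbalanced_transport.

(* Main.v *)
Require Import Defs.
From HB Require Import structures.
From mathcomp Require Import all_boot all_order all_algebra.
From mathcomp Require Import all_classical all_reals all_analysis.
From mathcomp Require Import measurable_realfun lra ring.

Set Implicit Arguments.
Unset Strict Implicit.
Unset Printing Implicit Defensive.

Import Order.TTheory GRing.Theory Num.Theory.
Import numFieldNormedType.Exports.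

Local Open Scope classical_set_scope.
Local Open Scope ring_scope.
Local Open Scope ereal_scope.

(** Write K(x, z) = exp (- psi(x, z) / eps) and let k(x, y) be the integral of
K(x, z) K(y, z) with respect to lambda, so that c_eps = - eps ln k. If a plan
pi has density q with respect to mu (x) nu, its entropic cost, the integral of
c_eps plus eps KL, is eps times the integral of ln (q / k) with respect to pi.

The proof compares two densities with respect to mu (x) nu (x) lambda:
<<
   a(x, y, z) = q(x, y) / k(x, y) K(x, z) K(y, z)     (split_density)
   b(x, y, z) = f1(x, z) f2(y, z) g(z)                (glue_density)
>>
In a, the plan pi is extended by a third coordinate z whose conditional law is
proportional to K(x, .) K(y, .). In b, g is the density of a probability eta
with respect to lambda, and f1, f2 are those of two half plans p1, p2 with
respect to mu (x) eta and nu (x) eta; x and y are independent given z. With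
the half cost u_i = ln f_i + (ln g) / 2 - ln K,
<<
   ln (a / b) = ln (q / k) - (u_1 + u_2).
>>
Both densities have mass at most 1, so Gibbs' inequality gives a sign to the
integral of ln (a / b). Under the law of density a it reads: the half costs
of the marginals of a add up to at most the integral of ln (q / k)
(plan_splitting). Under the law of density b it reads: the plan obtained by
gluing p1 and p2 along z has an integral of ln (q / k) which is at most the
sum of the two half costs (plan_gluing).

Debiasedness. Split a plan pi of finite cost into p1 and p2, then glue p1 to
itself and p2 to itself. The two plans obtained have both marginals equal to
the first, respectively to the second marginal of pi, and their costs add up
to at most twice the cost of pi (debiased_plans). As the marginals are those
of pi, the Csiszar terms of the unbalanced problem are unchanged.

Representation. The integral of eps u_i is the integral of psi, plus
eps KL(p_i | mu_i (x) eta), plus half of eps KL(eta | lambda)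
(half_cost_value); splitting and gluing are then the two inequalities.

Comparison with c. Since psi(x, z) + psi(y, z) >= c(x, y) for all z, a
probability lambda gives k <= exp (- c / eps), that is c <= c_eps.

None of the functions above is integrable in general. The argument only adds
functions whose negative parts are integrable, and the point that needs care
is the negative part of the half costs. In the representation formula it is
controlled by the hypothesis on psi. For debiasedness nothing is known on psi
alone, and the control comes from the cost of the diagonal coupling of a
marginal with itself (quasi_integrable_half_cost). *)

(** * Integrals of functions with integrable negative part *)

Section ereal_parts.
Context (R : realType).
Implicit Types a b : \bar R.

Lemma maxeN_subadd a b : maxe (- (a + b)) 0 <= maxe (- a) 0 + maxe (- b) 0.
Proof.
move: a b => [r| |] [s| |] /=; rewrite ?maxye ?maxNye -?EFin_max ?leey//=.
- by rewrite lee_fin /Num.max; repeat case: ifPn => ?; lra.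
- by rewrite lee_fin addr0 le_max lexx orbT.
- by rewrite lee_fin add0r le_max lexx orbT.
- by rewrite lee_fin addr0.
Qed.

(** The identity u^+ + f^- + g^- = u^- + f^+ + g^+ for u = f + g. It holds with
the convention oo - oo = -oo too, which is what lets integrals be added
without discussing where f or g is infinite. *)
Lemma maxeD_rearrange a b :
  maxe (a + b) 0 + (maxe (- a) 0 + maxe (- b) 0) =
  maxe (- (a + b)) 0 + (maxe a 0 + maxe b 0).
Proof.
move: a b => [r| |] [s| |] /=; rewrite ?maxye ?maxNye -?EFin_max//=.
by congr EFin; rewrite /Num.max; repeat case: ifPn => ?; lra.
Qed.

End ereal_parts.

Section quasi_integrable.
Context d (T : measurableType d) (R : realType) (mu : {measure set T -> \bar R}).
Implicit Types f g : T -> \bar R.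

(** The integral is then a well-defined element of ]-oo, +oo]. *)
Definition quasi_integrable f :=
  measurable_fun setT f /\ \int[mu]_x f^\- x < +oo.

Lemma quasi_integrable_ae_ge f g : measurable_fun setT f ->
  quasi_integrable g -> {ae mu, forall x, g x <= f x} -> quasi_integrable f.
Proof.
move=> mf [mg gN] gf; split => //; apply: le_lt_trans gN.
apply: ae_ge0_le_integral => //; try exact: measurable_funeneg.
apply: filterS gf => x gf _; rewrite !funenegE ge_max le_max leeN2 gf/=.
by rewrite le_max lexx orbT.
Qed.

Lemma ae_le_integral f g : measurable_fun setT f -> measurable_fun setT g ->
  {ae mu, forall x, f x <= g x} -> \int[mu]_x f x <= \int[mu]_x g x.
Proof.
move=> mf mg fg; rewrite integralE [leRHS]integralE leeB//.
- apply: ae_ge0_le_integral => //; try exact: measurable_funepos.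
  by apply: filterS fg => x fg _; rewrite !funeposE ge_max !le_max fg/= lexx orbT.
- apply: ae_ge0_le_integral => //; try exact: measurable_funeneg.
  apply: filterS fg => x fg _; rewrite !funenegE ge_max !le_max leeN2 fg/=.
  by rewrite lexx orbT.
Qed.

Lemma quasi_integrable_gtNy f : quasi_integrable f -> \int[mu]_x f x != -oo.
Proof.
move=> [mf fN]; rewrite integralE.
have : 0 <= \int[mu]_x f^\+ x by exact: integral_ge0.
have : 0 <= \int[mu]_x f^\- x by exact: integral_ge0.
by move: fN; case: (\int[mu]_x f^\- x) => [r| |]//; case: (\int[mu]_x f^\+ x).
Qed.

Lemma integralD_quasi f g : quasi_integrable f -> quasi_integrable g ->
  quasi_integrable (f \+ g) /\
  \int[mu]_x (f x + g x) = \int[mu]_x f x + \int[mu]_x g x.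
Proof.
move=> [mf fN] [mg gN].
have mfg : measurable_fun setT (f \+ g) by exact: emeasurable_funD.
have fgN : \int[mu]_x (f \+ g)^\- x < +oo.
  apply: (@le_lt_trans _ _ (\int[mu]_x (f^\- x + g^\- x))).
    apply: ge0_le_integral => //; try exact: measurable_funeneg.
    - by apply: emeasurable_funD; exact: measurable_funeneg.
    - by move=> x _; rewrite !funenegE maxeN_subadd.
  rewrite ge0_integralD//; try exact: measurable_funeneg.
  exact: lte_add_pinfty.
split => //; rewrite [LHS]integralE [in RHS]integralE (integralE _ _ g).
have : \int[mu]_x ((f \+ g)^\+ x + (f^\- x + g^\- x)) =
       \int[mu]_x ((f \+ g)^\- x + (f^\+ x + g^\+ x)).
  by apply: eq_integral => x _; rewrite !funeposE !funenegE maxeD_rearrange.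
rewrite !ge0_integralD//; try exact: measurable_funeneg;
  try exact: measurable_funepos; try (by move=> x _; apply: adde_ge0; rewrite ?funeneg_ge0 ?funepos_ge0);
  try (apply: emeasurable_funD; (exact: measurable_funeneg || exact: measurable_funepos)).
have p h : 0 <= \int[mu]_x h^\- x by exact: integral_ge0.
have q h : 0 <= \int[mu]_x h^\+ x by exact: integral_ge0.
move: fgN fN gN (p (f \+ g)) (p f) (p g) (q (f \+ g)) (q f) (q g).
case: (\int[mu]_x (f \+ g)^\- x) => [a| |]//.
case: (\int[mu]_x f^\- x) => [b| |]//.
case: (\int[mu]_x g^\- x) => [c| |]//.
case: (\int[mu]_x (f \+ g)^\+ x) => [u| |]// _ _ _ _ _ _;
case: (\int[mu]_x f^\+ x) => [v| |]//;
case: (\int[mu]_x g^\+ x) => [w| |]//= _ _ _.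
by move=> [?]; congr EFin; lra.
Qed.

Lemma integralZ_quasi (k : R) f : (0 <= k)%R -> quasi_integrable f ->
  quasi_integrable (fun x => k%:E * f x) /\
  \int[mu]_x (k%:E * f x) = k%:E * \int[mu]_x f x.
Proof.
move=> k0 [mf fN].
have kN : \int[mu]_x (fun x => k%:E * f x)^\- x = k%:E * \int[mu]_x f^\- x.
  by rewrite ge0_funenegM// ge0_integralZl_EFin//; exact: measurable_funeneg.
split; first by split; [exact: measurable_funeM|rewrite kN lte_mul_pinfty].
rewrite integralE kN ge0_funeposM// ge0_integralZl_EFin//; last exact: measurable_funepos.
rewrite -muleBr// -?integralE//.
have : 0 <= \int[mu]_x f^\- x by exact: integral_ge0.
by move: fN; case: (\int[mu]_x f^\- x) => //= r _ _; rewrite fin_num_adde_defl.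
Qed.

Lemma quasi_integrable_ae_lty f : quasi_integrable f -> \int[mu]_x f x < +oo ->
  {ae mu, forall x, f x < +oo}.
Proof.
move=> [mf fN] fy; suff : mu.-integrable setT f.
  move=> /(integrable_ae measurableT); apply: filterS => x /(_ I).
  by move=> /fin_numPlt/andP[].
apply/integrableP; split => //.
under eq_integral do rewrite -[`|_|]/((abse \o f) _) fune_abse.
rewrite ge0_integralD//; [|exact: measurable_funepos|exact: measurable_funeneg].
apply: lte_add_pinfty => //.
rewrite integralE in fy; move: fy fN.
have : 0 <= \int[mu]_x f^\+ x by exact: integral_ge0.
have : 0 <= \int[mu]_x f^\- x by exact: integral_ge0.
case: (\int[mu]_x f^\- x) => [r| |]//.
case: (\int[mu]_x f^\+ x) => [s _ _ _ _|_ _ h _|//].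
- exact: ltry.
- exact: h.
Qed.

End quasi_integrable.

(** Integrals are differences of suprema over simple functions lying below, so
they are monotone for arbitrary functions. This matters for the cost c, an
infimum over an uncountable set. *)
Lemma le_integral_pointwise d (T : measurableType d) (R : realType)
    (mu : {measure set T -> \bar R}) (f g : T -> \bar R) :
  (forall x, f x <= g x) -> \int[mu]_x f x <= \int[mu]_x g x.
Proof.
move=> fg; rewrite /integral !patch_setT; apply: leeB; apply: le_ereal_sup => _ [h hf <-];
  exists h => // x; apply: (le_trans (hf x)).
- by rewrite !funeposE ge_max !le_max fg/= lexx orbT.
- by rewrite !funenegE ge_max !le_max leeN2 fg/= lexx orbT.
Qed.

Section almost_everywhere.
Context d (T : measurableType d) (R : realType).
Implicit Types mu nu : {measure set T -> \bar R}.

Lemma ae_dominates mu nu (P : T -> Prop) : nu `<< mu ->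
  {ae mu, forall x, P x} -> {ae nu, forall x, P x}.
Proof.
move=> /null_content_dominatesP numu [N [mN muN PN]].
by exists N; split => //; exact: numu.
Qed.

Lemma ge0_integral_eq0_ae mu (f : T -> \bar R) : measurable_fun setT f ->
  (forall x, 0 <= f x) -> \int[mu]_x f x = 0 -> {ae mu, forall x, f x = 0}.
Proof.
move=> mf f0 int0; have : ae_eq mu setT f (cst 0).
  apply/ae_eq_integral_abs => //.
  by under eq_integral do rewrite gee0_abs//.
by apply: filterS => x /(_ I).
Qed.

End almost_everywhere.

(** * Measurability, and images of measures *)

Section measurable_real_operations.
Context d (T : measurableType d) (R : realType).

(** For nonnegative arguments the inverse is a real power. *)
Lemma measurable_fun_inv (f : T -> R) : (forall x, 0 <= f x)%R ->
  measurable_fun setT f -> measurable_fun setT (fun x => (f x)^-1)%R.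
Proof.
move=> f0 mf; under eq_fun do rewrite -powR_inv1//.
exact: (measurableT_comp (@measurable_powR R (-1))).
Qed.

Lemma measurable_fun_ln (f : T -> R) :
  measurable_fun setT f -> measurable_fun setT (fun x => ln (f x)).
Proof. by move=> mf; exact: measurableT_comp (@measurable_ln R) mf. Qed.

Lemma measurable_fun_sqrt (f : T -> R) :
  measurable_fun setT f -> measurable_fun setT (fun x => Num.sqrt (f x)).
Proof.
move=> mf; apply: (measurableT_comp _ mf).
apply: continuous_measurable_fun; exact: sqrt_continuous.
Qed.

Lemma measurable_fun_lne (f : T -> \bar R) :
  measurable_fun setT f -> measurable_fun setT (fun x => lne (f x)).
Proof.
move=> mf; have -> : (fun x => lne (f x)) =
  (fun x => if f x == +oo then +oo else
    if f x <= 0 then -oo else (ln (fine (f x)))%:E).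
  apply/funext => x; by case: (f x) => [r| |]; rewrite ?eqxx ?leNye//= lee_fin.
apply: measurable_fun_ifT => //; first exact: measurable_fun_eqe.
apply: measurable_fun_ifT => //; first exact: measurable_fun_lee.
exact/measurable_EFinP/measurable_fun_ln/measurableT_comp.
Qed.

End measurable_real_operations.

Section pushforward.
Context d1 d2 (X : measurableType d1) (Y : measurableType d2) (R : realType).
Variables (phi : X -> Y) (mphi : measurable_fun setT phi).
Implicit Types (mu : {measure set X -> \bar R}) (nu : {measure set Y -> \bar R}).

Lemma ge0_integral_image mu nu (h : Y -> \bar R) :
  (forall A, measurable A -> nu A = mu (phi @^-1` A)) ->
  measurable_fun setT h -> (forall y, 0 <= h y) ->
  \int[nu]_y h y = \int[mu]_x h (phi x).
Proof.
move=> nuE mh h0.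
rewrite (@eq_measure_integral _ _ _ setT (pushforward mu phi)).
  by rewrite ge0_integral_pushforward.
by move=> A mA _; rewrite nuE.
Qed.

Lemma integral_image mu nu (h : Y -> \bar R) :
  (forall A, measurable A -> nu A = mu (phi @^-1` A)) ->
  measurable_fun setT h ->
  \int[nu]_y h y = \int[mu]_x h (phi x).
Proof.
move=> nuE mh; rewrite integralE [RHS]integralE.
congr (_ - _); rewrite (ge0_integral_image nuE)//.
- by apply: eq_integral => x _; rewrite !funeposE.
- exact: measurable_funepos.
- by apply: eq_integral => x _; rewrite !funenegE.
- exact: measurable_funeneg.
Qed.

Lemma quasi_integrable_image mu nu (h : Y -> \bar R) :
  (forall A, measurable A -> nu A = mu (phi @^-1` A)) ->
  quasi_integrable nu h -> quasi_integrable mu (h \o phi).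
Proof.
move=> nuE [mh hN]; split; first exact: measurableT_comp.
move: hN; rewrite (ge0_integral_image nuE)//; last exact: measurable_funeneg.
by congr (_ < _); apply: eq_integral => x _; rewrite !funenegE.
Qed.

Lemma ae_image mu nu (P : Y -> Prop) :
  (forall A, measurable A -> nu A = mu (phi @^-1` A)) ->
  {ae nu, forall y, P y} -> {ae mu, forall x, P (phi x)}.
Proof.
move=> nuE [N [mN nuN PN]]; exists (phi @^-1` N); split => //.
- by rewrite -[X in measurable X]setTI; exact: mphi.
- by rewrite -nuE.
- by move=> x nP; exact: PN.
Qed.

End pushforward.

Section image_null_sets.
Context d1 d2 (X : measurableType d1) (Y : measurableType d2) (R : realType).
Variables (phi : X -> Y) (mphi : measurable_fun setT phi).
Variables (mu : {measure set X -> \bar R}) (nu : {measure set Y -> \bar R}).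
Hypothesis nuE : forall A, measurable A -> nu A = mu (phi @^-1` A).

Lemma image_ae (P : Y -> Prop) : measurable [set y | P y] ->
  {ae mu, forall x, P (phi x)} -> {ae nu, forall y, P y}.
Proof.
move=> mP [N [mN muN PN]]; exists (~` [set y | P y]); split => //.
- exact: measurableC.
- rewrite nuE; last exact: measurableC.
  apply: (subset_measure0 _ mN PN muN).
  by rewrite -[X in measurable X]setTI; exact: (mphi measurableT (measurableC mP)).
Qed.

End image_null_sets.

(** Stated on all sets, so that images compose without measurability conditions. *)
Lemma image_probability d1 d2 (X : measurableType d1) (Y : measurableType d2)
    (R : realType) (P : probability X R) (phi : X -> Y) :
  measurable_fun setT phi ->
  exists Q : probability Y R, forall A, Q A = P (phi @^-1` A).
Proof.
move=> mphi; pose mm := isMeasurableFun.Build _ _ _ _ phi mphi.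
pose f : {mfun X >-> Y} := HB.pack phi mm.
by exists (distribution P f).
Qed.

(** * Densities and relative entropy *)

Section density.
Context d (T : measurableType d) (R : realType).
Implicit Types (pi mu : {finite_measure set T -> \bar R}) (f : T -> R).

(** Densities are real-valued, so that logarithms and quotients of densities can
be computed in a field. *)
Definition has_density pi mu f :=
  [/\ measurable_fun setT f, forall x, (0 <= f x)%R &
      forall A, measurable A -> pi A = \int[mu]_(x in A) (f x)%:E].

Lemma density_dominates pi mu f : has_density pi mu f -> pi `<< mu.
Proof.
move=> [mf f0 piE]; apply/null_content_dominatesP => A mA muA.
rewrite piE// null_set_integral//.
exact/measurable_EFinP/measurable_funTS.
Qed.

Lemma dominates_density pi mu : pi `<< mu -> exists f, has_density pi mu f.
Proof.
move=> /radon_nikodym_sigma_finite[f [f0 ffin iF fE]].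
exists (fine \o f); split => /=.
- by apply: measurableT_comp => //; exact: measurable_int iF.
- by move=> x; exact: fine_ge0.
- by move=> A mA; rewrite fE//; apply: eq_integral => x _; rewrite fineK.
Qed.

Lemma probability_density_exists mu f : measurable_fun setT f ->
  (forall x, 0 <= f x)%R -> \int[mu]_x (f x)%:E = 1 ->
  exists pi : probability T R, has_density pi mu f.
Proof.
move=> mf f0 f1.
pose m A := \int[mu]_(x in A) (f x)%:E.
have m0 : m set0 = 0 by rewrite /m integral_set0.
have mge0 A : 0 <= m A by apply: integral_ge0 => x _; rewrite lee_fin.
have msigma : semi_sigma_additive m.
  move=> F mF tF mUF; rewrite /m ge0_integral_bigcup//.
  - by apply: is_cvg_ereal_nneg_natsum_cond => n _ _; exact: mge0.
  - exact/measurable_EFinP/measurable_funTS.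
  - by move=> x _; rewrite lee_fin.
pose mM := isMeasure.Build _ _ _ m m0 mge0 msigma.
pose M : {measure set T -> \bar R} := HB.pack m mM.
pose mP := Measure_isProbability.Build _ _ _ M f1.
pose P : probability T R := HB.pack m mM mP.
by exists P; split.
Qed.

Lemma ge0_integral_density pi mu f (h : T -> \bar R) : has_density pi mu f ->
  measurable_fun setT h -> (forall x, 0 <= h x) ->
  \int[pi]_x h x = \int[mu]_x (h x * (f x)%:E).
Proof.
move=> fpi mh h0; have pimu := density_dominates fpi; have [mf f0 piE] := fpi.
rewrite -(Radon_Nikodym_SigmaFinite.change_of_variables pimu)//.
have mg := measurable_int _ (Radon_Nikodym_SigmaFinite.f_integrable pimu).
apply: ae_eq_integral => //.
- exact: emeasurable_funM.
- by apply: emeasurable_funM => //; exact/measurable_EFinP.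
- apply: ae_eqe_mul2l; apply: integral_ae_eq => //.
  + exact: Radon_Nikodym_SigmaFinite.f_integrable.
  + exact/measurable_EFinP.
  + by move=> E _ mE; rewrite -Radon_Nikodym_SigmaFinite.f_integral// piE.
Qed.

Lemma density_gt0 pi mu f : has_density pi mu f -> {ae pi, forall x, (0 < f x)%R}.
Proof.
move=> [mf f0 piE]; exists [set x | f x = 0%R]; split.
- by rewrite -[X in measurable X]setTI; exact: (mf measurableT [set 0%R]).
- rewrite piE; last by rewrite -[X in measurable X]setTI; exact: (mf measurableT [set 0%R]).
  by apply: integral0_eq => x /= ->.
- by move=> x /= /negP; rewrite -leNgt => fx; apply/eqP; rewrite eq_le fx f0.
Qed.

(** The entropy can be computed with any density, since it is almost everywhere
equal to the chosen Radon-Nikodym derivative. *)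
Lemma KL_density pi mu f : has_density pi mu f ->
  KL pi mu = \int[pi]_x (ln (f x))%:E.
Proof.
move=> fpi; have pimu := density_dominates fpi; have [mf f0 piE] := fpi.
rewrite /KL asboolT//.
have mD : measurable_fun setT
  (Radon_Nikodym (charge_of_finite_measure pi) mu).
  by apply: measurable_int; exact: Radon_Nikodym_integrable.
apply: ae_eq_integral => //.
- exact: measurable_fun_lne.
- exact/measurable_EFinP/measurable_fun_ln.
have : ae_eq mu setT (Radon_Nikodym (charge_of_finite_measure pi) mu) (EFin \o f).
  apply: integral_ae_eq => //; first exact: Radon_Nikodym_integrable.
  - exact/measurable_EFinP.
  - by move=> E _ mE; rewrite -Radon_Nikodym_integral//; exact: piE.
have fgt0 := density_gt0 fpi.
move=> [N [mN N0 sN]]; have piN : pi N = 0.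
  by move/null_content_dominatesP : pimu; apply.
have : {ae pi, forall x, Radon_Nikodym (charge_of_finite_measure pi) mu x = (f x)%:E}.
  by exists N; split => // x /= nx; apply: sN => /= /(_ I).
by apply: filterS2 fgt0 => x fx -> _; rewrite lne_EFin.
Qed.

End density.

(** Testing on indicators identifies the image of a law of density a. *)
Lemma density_image d1 d2 (S : measurableType d1) (T : measurableType d2)
    (R : realType) (gam rho : {finite_measure set S -> \bar R})
    (p : {finite_measure set T -> \bar R}) (phi : S -> T) (a : S -> R) :
  measurable_fun setT phi -> has_density gam rho a ->
  (forall h : T -> \bar R, measurable_fun setT h -> (forall v, 0 <= h v) ->
    \int[rho]_t (h (phi t) * (a t)%:E) = \int[p]_v h v) ->
  forall A, measurable A -> p A = gam (phi @^-1` A).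
Proof.
move=> mphi dgam aI A mA.
have mphiA : measurable (phi @^-1` A) by rewrite -[X in measurable X]setTI; exact: mphi.
transitivity (\int[p]_v (\1_A v)%:E); first by rewrite integral_indic// setIT.
have m1A : measurable_fun setT (fun v => (\1_A v : R)%:E) by exact/measurable_EFinP.
rewrite -aI//.
transitivity (\int[gam]_t (\1_(phi @^-1` A) t)%:E); last by rewrite integral_indic ?setIT.
rewrite (ge0_integral_density dgam)//.
by apply/measurable_EFinP; exact: measurable_indic.
Qed.

Section log_inequality.
Context d (T : measurableType d) (R : realType) (gam : probability T R).

(** This is - ln w >= 1 - w, integrated. *)
Lemma quasi_integrable_oppln (w : T -> R) (C : R) : measurable_fun setT w ->
  {ae gam, forall x, (0 < w x)%R} -> \int[gam]_x (w x)%:E <= C%:E ->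
  quasi_integrable gam (fun x => (- ln (w x))%:E) /\
  (1 - C)%:E <= \int[gam]_x (- ln (w x))%:E.
Proof.
move=> mw w0 wC.
have mlnw : measurable_fun setT (fun x => (- ln (w x))%:E).
  by apply/measurable_EFinP/measurable_funN/measurable_fun_ln.
have iw : gam.-integrable setT (EFin \o w).
  apply/integrableP; split; first exact/measurable_EFinP.
  rewrite (@ae_eq_integral _ _ _ gam _ (EFin \o w))//.
  - exact: le_lt_trans wC (ltry _).
  - by apply: measurableT_comp => //; exact/measurable_EFinP.
  - exact/measurable_EFinP.
  - by apply: filterS w0 => x w0 _ /=; rewrite gtr0_norm.
have i1w : gam.-integrable setT (fun x => 1 - (w x)%:E).
  by apply: integrableB => //; exact: finite_measure_integrable_cst.
have ln_ge : {ae gam, forall x, 1 - (w x)%:E <= (- ln (w x))%:E}.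
  apply: filterS w0 => x w0; rewrite -EFinB lee_fin.
  have := @le_ln1Dx R (w x - 1); rewrite addrCA subrr addr0 => h.
  by rewrite lerNr opprB h//; lra.
split.
  apply: (@quasi_integrable_ae_ge _ _ _ _ _ (fun x => 1 - (w x)%:E)) => //.
  by split; [exact: measurable_int i1w|exact: integral_funeneg_lt_pinfty].
apply: (@le_trans _ _ (\int[gam]_x (1 - (w x)%:E))); last first.
  by apply: ae_le_integral => //; exact: measurable_int i1w.
rewrite integralB//=; last exact: finite_measure_integrable_cst.
rewrite integral_cst//= probability_setT mul1e EFinB.
by rewrite leeB.
Qed.

End log_inequality.

(** * Products of two and of three measures *)

Section tonelli.
Context d1 d2 (X : measurableType d1) (Y : measurableType d2) (R : realType).
Variables (mu : {finite_measure set X -> \bar R})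
          (nu : {finite_measure set Y -> \bar R}).

Lemma tonelli1 (f : X * Y -> \bar R) :
  measurable_fun setT f -> (forall p, 0 <= f p) ->
  \int[tensor mu nu]_p f p = \int[mu]_x \int[nu]_y f (x, y).
Proof. by move=> mf f0; exact: fubini_tonelli1. Qed.

Lemma tonelli2 (f : X * Y -> \bar R) :
  measurable_fun setT f -> (forall p, 0 <= f p) ->
  \int[tensor mu nu]_p f p = \int[nu]_y \int[mu]_x f (x, y).
Proof. by move=> mf f0; exact: fubini_tonelli2. Qed.

Lemma measurable_integral1 (f : X * Y -> \bar R) :
  measurable_fun setT f -> (forall p, 0 <= f p) ->
  measurable_fun setT (fun y => \int[mu]_x f (x, y)).
Proof. by move=> mf f0; exact: measurable_fun_fubini_tonelli_G. Qed.

Lemma measurable_integral2 (f : X * Y -> \bar R) :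
  measurable_fun setT f -> (forall p, 0 <= f p) ->
  measurable_fun setT (fun x => \int[nu]_y f (x, y)).
Proof. by move=> mf f0; exact: measurable_fun_fubini_tonelli_F. Qed.

Lemma tonelli_prod (f : X -> \bar R) (g : Y -> \bar R) :
  measurable_fun setT f -> measurable_fun setT g ->
  (forall x, 0 <= f x) -> (forall y, 0 <= g y) ->
  \int[tensor mu nu]_p (f p.1 * g p.2) = \int[mu]_x f x * \int[nu]_y g y.
Proof.
move=> mf mg f0 g0; rewrite tonelli1/=.
- rewrite -ge0_integralZr//; last exact: integral_ge0.
  by apply: eq_integral => x _; rewrite ge0_integralZl.
- by apply: emeasurable_funM; [exact: measurableT_comp|exact: measurableT_comp].
- by move=> p; rewrite mule_ge0.
Qed.

End tonelli.

Section gibbs.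
Context d (T : measurableType d) (R : realType).
Variables (gam : probability T R) (rho : {finite_measure set T -> \bar R}).

(** Applied to w = b / a, whose integral under the law of density a is at most
that of b. With C = 1 it says that a relative entropy is nonnegative; other
values of C only serve to bound the negative part. *)
Lemma gibbs_inequality (a b : T -> R) (C : R) : has_density gam rho a ->
  measurable_fun setT b -> (forall x, 0 <= b x)%R ->
  {ae gam, forall x, (0 < b x)%R} -> \int[rho]_x (b x)%:E <= C%:E ->
  quasi_integrable gam (fun x => (ln (a x) - ln (b x))%:E) /\
  (1 - C)%:E <= \int[gam]_x (ln (a x) - ln (b x))%:E.
Proof.
move=> dgam mb b0 bgt0 bC; have [ma a0 _] := dgam.
have agt0 := density_gt0 dgam.
pose w x := (b x / a x)%R.
have mw : measurable_fun setT w by apply: measurable_funM => //; exact: measurable_fun_inv.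
have w0 : {ae gam, forall x, (0 < w x)%R}.
  by apply: filterS2 agt0 bgt0 => x ax bx; rewrite divr_gt0.
have wC : \int[gam]_x (w x)%:E <= C%:E.
  rewrite (ge0_integral_density dgam); [|exact/measurable_EFinP|
    by move=> x; rewrite lee_fin divr_ge0].
  apply: le_trans bC; apply: ge0_le_integral => //.
  - by move=> x _; rewrite -EFinM lee_fin mulr_ge0// divr_ge0.
  - by apply: emeasurable_funM; exact/measurable_EFinP.
  - exact/measurable_EFinP.
  - move=> x _; rewrite -EFinM lee_fin /w -mulrA.
    by have [->|an0] := eqVneq (a x) 0%R; rewrite ?mulr0// mulVf// mulr1.
have [qw lw] := quasi_integrable_oppln mw w0 wC.
have mln : measurable_fun setT (fun x => (ln (a x) - ln (b x))%:E).
  by apply/measurable_EFinP/measurable_funB; exact: measurable_fun_ln.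
have wE : {ae gam, forall x, (- ln (w x))%:E = (ln (a x) - ln (b x))%:E}.
  by apply: filterS2 agt0 bgt0 => x ax bx; rewrite /w ln_div// opprB.
split.
  by apply: quasi_integrable_ae_ge mln qw _; apply: filterS wE => x ->.
apply: (le_trans lw); apply: ae_le_integral => //; first by case: qw.
by apply: filterS wE => x ->.
Qed.

End gibbs.

(** Gibbs' inequality against the constant density 1. *)
Lemma quasi_integrable_ln_density d (T : measurableType d) (R : realType)
    (pi : probability T R) (mu : {finite_measure set T -> \bar R}) (f : T -> R) :
  has_density pi mu f -> quasi_integrable pi (fun x => (ln (f x))%:E).
Proof.
move=> dpi.
have [] := @gibbs_inequality _ _ _ pi mu f (cst 1%R) (fine (mu setT)) dpi
   (measurable_cst _) (fun=> ler01) (aeW _ (fun=> ltr01)).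
  by rewrite fineK ?fin_num_measure// -[leRHS]mul1e -integral_cst.
by under eq_fun do rewrite ln1 subr0.
Qed.

Section triple_product.
Context dx dy dz (X : measurableType dx) (Y : measurableType dy)
  (Z : measurableType dz) (R : realType).

Definition proj13 (t : X * Y * Z) : X * Z := (t.1.1, t.2).
Definition proj23 (t : X * Y * Z) : Y * Z := (t.1.2, t.2).

Lemma measurable_proj13 : measurable_fun setT proj13.
Proof.
by apply: measurable_fun_pair => //; exact: measurableT_comp.
Qed.

Lemma measurable_proj23 : measurable_fun setT proj23.
Proof.
by apply: measurable_fun_pair => //; exact: measurableT_comp.
Qed.

Variables (mu : {finite_measure set X -> \bar R})
  (nu : {finite_measure set Y -> \bar R}) (lam : {finite_measure set Z -> \bar R}).

(** Given z, the two factors depend on separate variables. *)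
Lemma tonelli_triple (f : X * Z -> \bar R) (g : Y * Z -> \bar R) :
  measurable_fun setT f -> measurable_fun setT g ->
  (forall p, 0 <= f p) -> (forall p, 0 <= g p) ->
  \int[tensor (tensor mu nu) lam]_t (f (proj13 t) * g (proj23 t)) =
  \int[lam]_z (\int[mu]_x f (x, z) * \int[nu]_y g (y, z)).
Proof.
move=> mf mg f0 g0; rewrite tonelli2//=.
- apply: eq_integral => z _; rewrite -tonelli_prod//.
  + exact: measurable_fun_pair1.
  + exact: measurable_fun_pair1.
- apply: emeasurable_funM; first exact: measurableT_comp mf measurable_proj13.
  exact: measurableT_comp mg measurable_proj23.
- by move=> t; rewrite mule_ge0.
Qed.

End triple_product.
Arguments proj13 {dx dy dz X Y Z}.
Arguments proj23 {dx dy dz X Y Z}.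

Section fibres.
Context dx dz (X : measurableType dx) (Z : measurableType dz) (R : realType).
Variables (mu : {finite_measure set X -> \bar R}) (eta : probability Z R).

(** The conditional laws given z have mass 1: both sides of the equation have the
same integral over every measurable set of z. *)
Lemma density_fibre_mass (p : probability (X * Z)%type R) (f : X * Z -> R) :
  has_density p (tensor mu eta) f ->
  (forall B, measurable B -> p (snd @^-1` B) = eta B) ->
  {ae eta, forall z, \int[mu]_x (f (x, z))%:E = 1}.
Proof.
move=> [mf f0 pE] p2.
have mEf : measurable_fun setT (EFin \o f) by exact/measurable_EFinP.
have mi : measurable_fun setT (fun z => \int[mu]_x (f (x, z))%:E).
  by apply: (measurable_integral1 mu mEf) => q; rewrite lee_fin.
have iB B : measurable B -> \int[eta]_(z in B) \int[mu]_x (f (x, z))%:E = eta B.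
  move=> mB; rewrite -p2//.
  have mB2 : measurable (snd @^-1` B : set (X * Z)%type).
    by rewrite -[X in measurable X]setTI; exact: measurable_snd.
  rewrite pE// integral_mkcond [RHS]integral_mkcond tonelli2.
  - apply: eq_integral => z _; rewrite patchE.
    have [zB|zB] := pselect (B z).
      by rewrite mem_set//; apply: eq_integral => x _; rewrite patchE mem_set.
    by rewrite memNset// integral0_eq// => x _; rewrite patchE memNset.
  - by apply/(measurable_restrictT _ mB2); exact: measurable_funTS.
  - by move=> q; apply: erestrict_ge0 => ? _; rewrite lee_fin.
have : ae_eq eta setT (cst 1) (fun z => \int[mu]_x (f (x, z))%:E).
  apply: integral_ae_eq => //; first exact: finite_measure_integrable_cst.
  by move=> B _ mB; rewrite iB// integral_cst//= mul1e.
by apply: filterS => z /(_ I) /= <-.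
Qed.

End fibres.

(** * Two densities on a triple product *)

Section splitting_and_gluing.
Context dx dy dz (X : measurableType dx) (Y : measurableType dy)
  (Z : measurableType dz) (R : realType).

(** What is left of a law on X * Y * Z when one of x and y is forgotten. The first
marginal is left free, because in unbalanced transport it differs from mu. *)
Definition half_plan d (W : measurableType d) (mu : {finite_measure set W -> \bar R})
    (eta : probability Z R) (K : W * Z -> R)
    (p : probability (W * Z)%type R) (f : W * Z -> R) :=
  [/\ has_density p (tensor mu eta) f,
      forall B, measurable B -> p (snd @^-1` B) = eta B &
      {ae p, forall v, (0 < K v)%R}].

(** The logarithm of f sqrt(g) / K. Sharing g equally between the two halves is
what makes the half costs of a glued plan add up. *)
Definition half_cost W (K : W * Z -> R) (g : Z -> R) (f : W * Z -> R) (v : W * Z) : R :=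
  (ln (f v) + 2^-1 * ln (g v.2) - ln (K v))%R.

Lemma measurable_half_cost d (W : measurableType d) (K : W * Z -> R) g f :
  measurable_fun setT K -> measurable_fun setT g -> measurable_fun setT f ->
  measurable_fun setT (half_cost K g f).
Proof.
move=> mK mg mf; apply: measurable_funB; last exact: measurable_fun_ln.
apply: measurable_funD; first exact: measurable_fun_ln.
by apply: measurable_funM => //; apply: measurable_fun_ln; exact: measurableT_comp mg _.
Qed.

Variables (mu : {finite_measure set X -> \bar R})
  (nu : {finite_measure set Y -> \bar R}) (lam : {finite_measure set Z -> \bar R}).
Variables (K1 : X * Z -> R) (K2 : Y * Z -> R) (k : X * Y -> R).
Hypotheses (mK1 : measurable_fun setT K1) (mK2 : measurable_fun setT K2)
  (K1_ge0 : forall v, (0 <= K1 v)%R) (K2_ge0 : forall v, (0 <= K2 v)%R)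
  (kE : forall v, (k v)%:E = \int[lam]_z (K1 (v.1, z) * K2 (v.2, z))%:E).

Let m13 := @measurable_proj13 _ _ _ X Y Z.
Let m23 := @measurable_proj23 _ _ _ X Y Z.

Let mKK : measurable_fun setT
  (fun t : X * Y * Z => (K1 (proj13 t) * K2 (proj23 t))%:E).
Proof.
apply/measurable_EFinP/measurable_funM.
  exact: measurableT_comp mK1 m13.
exact: measurableT_comp mK2 m23.
Qed.

Lemma kernel_ge0 v : (0 <= k v)%R.
Proof.
by rewrite -lee_fin kE; apply: integral_ge0 => z _; rewrite lee_fin mulr_ge0.
Qed.

Lemma measurable_kernel : measurable_fun setT k.
Proof.
apply/measurable_EFinP; rewrite (_ : EFin \o k =
    fun v => \int[lam]_z (K1 (proj13 (v, z)) * K2 (proj23 (v, z)))%:E).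
  by apply: (measurable_integral2 lam mKK) => t; rewrite lee_fin mulr_ge0.
by apply/funext => v /=; rewrite kE.
Qed.

Let mk := measurable_kernel.
Let k_ge0 := kernel_ge0.

Let rho := tensor (tensor mu nu) lam.

Section split_density.
Variables (pi : probability (X * Y)%type R) (q : X * Y -> R).
Hypothesis qpi : has_density pi (tensor mu nu) q.

Definition split_density (t : X * Y * Z) : R :=
  (q t.1 / k t.1 * (K1 (proj13 t) * K2 (proj23 t)))%R.

Lemma split_density_ge0 t : (0 <= split_density t)%R.
Proof. by have [_ q0 _] := qpi; rewrite mulr_ge0// ?divr_ge0// mulr_ge0. Qed.

Lemma measurable_split_density : measurable_fun setT split_density.
Proof.
have [mq _ _] := qpi; apply: measurable_funM; last exact/measurable_EFinP.
apply: measurable_funM; first exact: measurableT_comp mq measurable_fst.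
by apply: measurable_fun_inv => //; exact: (measurableT_comp mk).
Qed.

(** Integrating z out replaces K K by k. The factor k / k, which is 1 except
where k vanishes, accounts for the part of pi on which the cost is infinite. *)
Lemma split_density_integral (h : X * Y -> \bar R) :
  measurable_fun setT h -> (forall v, 0 <= h v) ->
  \int[rho]_t (h t.1 * (split_density t)%:E) =
  \int[pi]_v (h v * (k v / k v)%:E).
Proof.
move=> mh h0; have [mq q0 _] := qpi.
have mki : measurable_fun setT (fun v => (k v)^-1)%R by exact: measurable_fun_inv.
rewrite tonelli1; last 2 first.
- apply: emeasurable_funM; first exact: measurableT_comp mh measurable_fst.
  by apply/measurable_EFinP; exact: measurable_split_density.
- by move=> t; rewrite mule_ge0// lee_fin split_density_ge0.
rewrite (ge0_integral_density qpi); last 2 first.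
- apply: emeasurable_funM => //.
  by apply/measurable_EFinP; exact: measurable_funM.
- by move=> v; rewrite mule_ge0// lee_fin divr_ge0.
apply: eq_integral => v _; rewrite /split_density/=.
under eq_integral do rewrite EFinM muleA.
rewrite ge0_integralZl//=.
- by rewrite -kE -!muleA -!EFinM; congr (_ * _%:E); rewrite mulrAC -mulrA mulrC.
- exact: measurableT_comp mKK (pair1_measurable v).
- by move=> z _; rewrite lee_fin mulr_ge0.
- by rewrite mule_ge0// lee_fin divr_ge0.
Qed.

End split_density.

Section glue_density.
Variables (eta : probability Z R) (g : Z -> R).
Variables (p1 : probability (X * Z)%type R) (f1 : X * Z -> R).
Variables (p2 : probability (Y * Z)%type R) (f2 : Y * Z -> R).
Hypotheses (geta : has_density eta lam g)
  (hp1 : half_plan mu eta K1 p1 f1) (hp2 : half_plan nu eta K2 p2 f2).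

Definition glue_density (t : X * Y * Z) : R :=
  (f1 (proj13 t) * f2 (proj23 t) * g t.2)%R.

Lemma glue_density_ge0 t : (0 <= glue_density t)%R.
Proof.
have [_ g0 _] := geta; have [[_ f10 _] _ _] := hp1; have [[_ f20 _] _ _] := hp2.
by rewrite mulr_ge0// mulr_ge0.
Qed.

Lemma measurable_glue_density : measurable_fun setT glue_density.
Proof.
have [mg _ _] := geta; have [[mf1 _ _] _ _] := hp1; have [[mf2 _ _] _ _] := hp2.
apply: measurable_funM; last exact: measurableT_comp mg measurable_snd.
apply: measurable_funM; first exact: measurableT_comp mf1 m13.
exact: measurableT_comp mf2 m23.
Qed.

Lemma glue_density_integral (h1 : X * Z -> \bar R) (h2 : Y * Z -> \bar R) :
  measurable_fun setT h1 -> (forall v, 0 <= h1 v) ->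
  measurable_fun setT h2 -> (forall v, 0 <= h2 v) ->
  \int[rho]_t (h1 (proj13 t) * h2 (proj23 t) * (glue_density t)%:E) =
  \int[eta]_z ((\int[mu]_x (h1 (x, z) * (f1 (x, z))%:E)) *
               (\int[nu]_y (h2 (y, z) * (f2 (y, z))%:E))).
Proof.
move=> mh1 h10 mh2 h20.
have [mg g0 _] := geta; have [[mf1 f10 _] _ _] := hp1; have [[mf2 f20 _] _ _] := hp2.
have mhf1 : measurable_fun setT (fun v => h1 v * (f1 v)%:E).
  by apply: emeasurable_funM => //; exact/measurable_EFinP.
have mhf2 : measurable_fun setT (fun v => h2 v * (f2 v)%:E).
  by apply: emeasurable_funM => //; exact/measurable_EFinP.
have hf10 v : 0 <= h1 v * (f1 v)%:E by rewrite mule_ge0// lee_fin.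
have hf20 v : 0 <= h2 v * (f2 v)%:E by rewrite mule_ge0// lee_fin.
have mg1 : measurable_fun setT (fun v : X * Z => (g v.2)%:E).
  by apply/measurable_EFinP; exact: measurableT_comp mg measurable_snd.
rewrite (ge0_integral_density geta); last 2 first.
- by apply: emeasurable_funM;
    [apply: (measurable_integral1 mu mhf1)|apply: (measurable_integral1 nu mhf2)].
- by move=> z; rewrite mule_ge0//; exact: integral_ge0.
pose a (v : X * Z) := h1 v * (f1 v)%:E * (g v.2)%:E.
pose b (v : Y * Z) := h2 v * (f2 v)%:E.
transitivity (\int[rho]_t (a (proj13 t) * b (proj23 t))).
  apply: eq_integral => t _; rewrite /glue_density/= !EFinM.
  by rewrite [RHS]muleAC [in RHS]muleACA !muleA.
rewrite tonelli_triple//.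
- apply: eq_integral => z _; rewrite /a /= ge0_integralZr//.
  + by rewrite muleAC.
  + exact: measurable_fun_pair1 mhf1.
  + by rewrite lee_fin.
- exact: emeasurable_funM.
- by move=> v; rewrite mule_ge0// lee_fin.
Qed.

(** By density_fibre_mass the variable y integrates to 1 for almost every z. *)
Lemma glue_density_integral1 (h : X * Z -> \bar R) :
  measurable_fun setT h -> (forall v, 0 <= h v) ->
  \int[rho]_t (h (proj13 t) * (glue_density t)%:E) = \int[p1]_v h v.
Proof.
move=> mh h0; have [df1 _ _] := hp1; have [df2 e2 _] := hp2.
have [mf1 f10 _] := df1; have [mf2 f20 _] := df2.
have mhf1 : measurable_fun setT (fun v => h v * (f1 v)%:E).
  by apply: emeasurable_funM => //; exact/measurable_EFinP.
have hf10 v : 0 <= h v * (f1 v)%:E by rewrite mule_ge0// lee_fin.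
have mh1 := measurable_integral1 mu mhf1 hf10.
have mf2' : measurable_fun setT (fun v => (f2 v)%:E) by exact/measurable_EFinP.
transitivity (\int[rho]_t (h (proj13 t) * cst 1 (proj23 t) * (glue_density t)%:E)).
  by apply: eq_integral => t _; rewrite mule1.
rewrite glue_density_integral// (ge0_integral_density df1)// tonelli2//.
apply: ae_eq_integral => //.
  apply: emeasurable_funM => //.
  under eq_fun do under eq_integral do rewrite mul1e.
  by apply: (measurable_integral1 nu mf2') => v; rewrite lee_fin.
apply: filterS (density_fibre_mass df2 e2) => z f2z _ /=.
by under [X in _ * X]eq_integral do rewrite mul1e; rewrite f2z mule1.
Qed.

Lemma glue_density_integral2 (h : Y * Z -> \bar R) :
  measurable_fun setT h -> (forall v, 0 <= h v) ->
  \int[rho]_t (h (proj23 t) * (glue_density t)%:E) = \int[p2]_v h v.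
Proof.
move=> mh h0; have [df1 e1 _] := hp1; have [df2 _ _] := hp2.
have [mf1 f10 _] := df1; have [mf2 f20 _] := df2.
have mhf2 : measurable_fun setT (fun v => h v * (f2 v)%:E).
  by apply: emeasurable_funM => //; exact/measurable_EFinP.
have hf20 v : 0 <= h v * (f2 v)%:E by rewrite mule_ge0// lee_fin.
have mh2 := measurable_integral1 nu mhf2 hf20.
have mf1' : measurable_fun setT (fun v => (f1 v)%:E) by exact/measurable_EFinP.
transitivity (\int[rho]_t (cst 1 (proj13 t) * h (proj23 t) * (glue_density t)%:E)).
  by apply: eq_integral => t _; rewrite mul1e.
rewrite glue_density_integral// (ge0_integral_density df2)// tonelli2//.
apply: ae_eq_integral => //.
  apply: emeasurable_funM => //.
  under eq_fun do under eq_integral do rewrite mul1e.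
  by apply: (measurable_integral1 mu mf1') => v; rewrite lee_fin.
apply: filterS (density_fibre_mass df1 e1) => z f1z _ /=.
by under [X in X * _]eq_integral do rewrite mul1e; rewrite f1z mul1e.
Qed.

End glue_density.

(** The algebraic identity behind both splitting and gluing. *)
Lemma ln_split_sub_glue q g f1 f2 (t : X * Y * Z) :
  (0 < q t.1 -> 0 < k t.1 -> 0 < K1 (proj13 t) -> 0 < K2 (proj23 t) ->
   0 < g t.2 -> 0 < f1 (proj13 t) -> 0 < f2 (proj23 t) ->
  ln (split_density q t) - ln (glue_density g f1 f2 t) =
  (ln (q t.1) - ln (k t.1)) -
  (half_cost K1 g f1 (proj13 t) + half_cost K2 g f2 (proj23 t)))%R.
Proof.
move=> q0 k0 K10 K20 g0 f10 f20; rewrite /split_density /glue_density /half_cost/=.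
rewrite !lnM ?lnV ?posrE ?divr_gt0 ?mulr_gt0 ?invr_gt0//.
by lra.
Qed.

End splitting_and_gluing.

Section half_plan_dominates.
Context dw dz (W : measurableType dw) (Z : measurableType dz) (R : realType).
Variables (mu : {finite_measure set W -> \bar R}) (eta : probability Z R).

(** For eta-almost every z the section of a null set of mu (x) eta is mu-null, so
the part of the set lying over the remaining z is negligible for p; over the
other z all sections are null. *)
Lemma half_plan_dominates (p : probability (W * Z)%type R) :
  (forall B, measurable B -> p (snd @^-1` B) = eta B) ->
  (forall E, measurable E -> (forall z, \int[mu]_w (\1_E (w, z))%:E = 0) ->
    p E = 0) ->
  p `<< tensor mu eta.
Proof.
move=> p2 null; apply/null_content_dominatesP => A mA A0.
pose m z := \int[mu]_w (\1_A (w, z))%:E.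
have m1A : measurable_fun setT (fun v : W * Z => (\1_A v : R)%:E).
  by apply/measurable_EFinP.
have mm : measurable_fun setT m.
  by apply: (measurable_integral1 mu m1A) => v; rewrite lee_fin.
have m0 z : 0 <= m z by apply: integral_ge0 => w _; rewrite lee_fin.
have aem : {ae eta, forall z, m z = 0}.
  apply: ge0_integral_eq0_ae => //.
  have : \int[tensor mu eta]_v (\1_A v)%:E = 0 by rewrite integral_indic// setIT.
  by rewrite tonelli2// => v; rewrite lee_fin.
pose B := [set z | m z = 0].
have mB : measurable B.
  by rewrite -[X in measurable X]setTI; exact: (mm measurableT [set 0]).
have mS (C : set Z) : measurable C -> measurable (snd @^-1` C : set (W * Z)%type).
  by move=> mC; rewrite -[X in measurable X]setTI; exact: measurable_snd.
have etaB : eta (~` B) = 0 by apply/negligibleP => //; exact: measurableC.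
have mAB : measurable (A `&` snd @^-1` B) by apply: measurableI => //; exact: mS.
have mAnB : measurable (A `&` ~` (snd @^-1` B)).
  by apply: measurableI => //; apply: measurableC; exact: mS.
have pAB : p (A `&` snd @^-1` B) = 0.
  apply: null => // z; have [Bz|nBz] := pselect (B z).
    rewrite -[RHS]Bz; apply: eq_integral => w _; congr (_%:E).
    rewrite !indicE; congr (nat_of_bool _)%:R.
    by apply/idP/idP; rewrite !inE => h; [case: h|split].
  rewrite integral0_eq// => w _; rewrite indicE memNset//.
  by case.
have pAnB : p (A `&` ~` (snd @^-1` B)) = 0.
  apply/eqP; rewrite eq_le measure_ge0 andbT -etaB -p2; last exact: measurableC.
  apply: le_measure; rewrite ?inE//.
  by apply: mS; exact: measurableC.
rewrite -(setIT A) -(setUv (snd @^-1` B)) setIUr measureU//; last first.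
  by rewrite setIACA setICr setI0.
by rewrite [X in X + _]pAB [X in _ + X]pAnB adde0.
Qed.

End half_plan_dominates.

(** * Splitting a plan, and gluing two half plans *)

Section splitting_and_gluing_theorems.
Context dx dy dz (X : measurableType dx) (Y : measurableType dy)
  (Z : measurableType dz) (R : realType).
Variables (mu : {finite_measure set X -> \bar R})
  (nu : {finite_measure set Y -> \bar R}) (lam : {finite_measure set Z -> \bar R}).
Variables (K1 : X * Z -> R) (K2 : Y * Z -> R) (k : X * Y -> R).
Hypotheses (mK1 : measurable_fun setT K1) (mK2 : measurable_fun setT K2)
  (K1_ge0 : forall v, (0 <= K1 v)%R) (K2_ge0 : forall v, (0 <= K2 v)%R)
  (kE : forall v, (k v)%:E = \int[lam]_z (K1 (v.1, z) * K2 (v.2, z))%:E).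

Let m13 := @measurable_proj13 _ _ _ X Y Z.
Let m23 := @measurable_proj23 _ _ _ X Y Z.
Let mk := measurable_kernel mK1 mK2 K1_ge0 K2_ge0 kE.
Let k_ge0 := kernel_ge0 K1_ge0 K2_ge0 kE.
Let rho := tensor (tensor mu nu) lam.

Let rhoT A : measurable A -> rho A = \int[rho]_t (\1_A t)%:E.
Proof. by move=> mA; rewrite integral_indic// setIT. Qed.

Let rho13_null (E : set (X * Z)%type) : measurable E ->
  (forall z, \int[mu]_x (\1_E (x, z))%:E = 0) -> rho (proj13 @^-1` E) = 0.
Proof.
move=> mE E0; rewrite rhoT; last first.
  by rewrite -[X in measurable X]setTI; exact: m13.
have mE1 : measurable_fun setT (fun v => (\1_E v : R)%:E) by exact/measurable_EFinP.
have E10 v : 0 <= (\1_E v : R)%:E by rewrite lee_fin.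
have := tonelli_triple mu nu lam mE1
  (@measurable_cst _ _ (Y * Z)%type _ setT (1 : \bar R)) E10 (fun=> lee01).
under eq_integral do rewrite mule1.
under [X in _ = X -> _]eq_integral do rewrite E0 mul0e.
by rewrite integral0.
Qed.

Let rho23_null (E : set (Y * Z)%type) : measurable E ->
  (forall z, \int[nu]_y (\1_E (y, z))%:E = 0) -> rho (proj23 @^-1` E) = 0.
Proof.
move=> mE E0; rewrite rhoT; last first.
  by rewrite -[X in measurable X]setTI; exact: m23.
have mE1 : measurable_fun setT (fun v => (\1_E v : R)%:E) by exact/measurable_EFinP.
have E10 v : 0 <= (\1_E v : R)%:E by rewrite lee_fin.
have := tonelli_triple mu nu lam
  (@measurable_cst _ _ (X * Z)%type _ setT (1 : \bar R)) mE1 (fun=> lee01) E10.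
under eq_integral do rewrite mul1e.
under [X in _ = X -> _]eq_integral do rewrite E0 mule0.
by rewrite integral0.
Qed.

Let rho3_null B : measurable B -> lam B = 0 -> rho (snd @^-1` B) = 0.
Proof.
move=> mB B0; rewrite (_ : snd @^-1` B = setT `*` B); last first.
  by apply/seteqP; split => t //= [].
by rewrite /rho /tensor product_measure1E// [X in _ * X]B0 mule0.
Qed.

Let rho12_null B : measurable B -> tensor mu nu B = 0 -> rho (fst @^-1` B) = 0.
Proof.
move=> mB B0; rewrite (_ : fst @^-1` B = B `*` setT); last first.
  by apply/seteqP; split => t //= [].
rewrite {1}/rho {1}/tensor product_measure1E//.
by rewrite [X in X * _]B0 mul0e.
Qed.

Section gibbs_of_plan.
Variables (eta : probability Z R) (g : Z -> R).
Variables (p1 : probability (X * Z)%type R) (f1 : X * Z -> R).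
Variables (p2 : probability (Y * Z)%type R) (f2 : Y * Z -> R).
Variables (pi : probability (X * Y)%type R) (q : X * Y -> R).
Variable (gam : probability (X * Y * Z)%type R).
Hypotheses (geta : has_density eta lam g)
  (hp1 : half_plan mu eta K1 p1 f1) (hp2 : half_plan nu eta K2 p2 f2)
  (qpi : has_density pi (tensor mu nu) q) (kpi : {ae pi, forall v, (0 < k v)%R}).
Hypotheses
  (gampi : forall A, measurable A -> pi A = gam (fst @^-1` A))
  (gam1 : forall A, measurable A -> p1 A = gam (proj13 @^-1` A))
  (gam2 : forall A, measurable A -> p2 A = gam (proj23 @^-1` A)).

Let a := split_density K1 K2 k q.
Let b := glue_density g f1 f2.

Let pos : {ae gam, forall t : X * Y * Z,
  [/\ 0 < q t.1, 0 < k t.1, 0 < K1 (proj13 t) & 0 < K2 (proj23 t)]%R /\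
  [/\ 0 < g t.2, 0 < f1 (proj13 t) & 0 < f2 (proj23 t)]%R}.
Proof.
have [df1 e1 K1p] := hp1; have [df2 e2 K2p] := hp2.
have mT : measurable_fun setT (fst : X * Y * Z -> X * Y) by exact: measurable_fst.
have h1 := ae_image mT gampi (density_gt0 qpi).
have h2 := ae_image mT gampi kpi.
have h3 := ae_image m13 gam1 K1p.
have h4 := ae_image m23 gam2 K2p.
have h6 := ae_image m13 gam1 (density_gt0 df1).
have h7 := ae_image m23 gam2 (density_gt0 df2).
have e3 B : measurable B -> eta B = gam (snd @^-1` B).
  move=> mB; rewrite -e1// gam1//.
  by rewrite -[X in measurable X]setTI; exact: measurable_snd.
have mS : measurable_fun setT (snd : X * Y * Z -> Z) by exact: measurable_snd.
have h5 := ae_image mS e3 (density_gt0 geta).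
by near=> t; split; [split|split]; near: t.
Unshelve. all: by end_near.
Qed.

Let ln_ab : {ae gam, forall t : X * Y * Z, (ln (a t) - ln (b t) =
  (ln (q t.1) - ln (k t.1)) -
  (half_cost K1 g f1 (proj13 t) + half_cost K2 g f2 (proj23 t)))%R}.
Proof.
apply: filterS pos => t [[q0 k0 K10 K20] [g0 f10 f20]].
exact: ln_split_sub_glue.
Qed.

Let L v := (ln (q v) - ln (k v))%:E.
Let U1 v := (half_cost K1 g f1 v)%:E.
Let U2 v := (half_cost K2 g f2 v)%:E.
Hypotheses (qU1 : quasi_integrable p1 U1) (qU2 : quasi_integrable p2 U2).

Let mL : measurable_fun setT L.
Proof.
have [mq _ _] := qpi.
by apply/measurable_EFinP; apply: measurable_funB; exact: measurable_fun_ln.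
Qed.

Let L_image : \int[pi]_v L v = \int[gam]_t L t.1.
Proof. by rewrite (integral_image _ gampi)//; exact: measurable_fst. Qed.

Let qU1g : quasi_integrable gam (U1 \o proj13).
Proof. exact: (quasi_integrable_image m13 gam1 qU1). Qed.

Let qU2g : quasi_integrable gam (U2 \o proj23).
Proof. exact: (quasi_integrable_image m23 gam2 qU2). Qed.

Let U_image : \int[p1]_v U1 v + \int[p2]_v U2 v =
  \int[gam]_t (U1 (proj13 t) + U2 (proj23 t)).
Proof.
have [[mU1 _] [mU2 _]] := (qU1, qU2).
rewrite (integral_image m13 gam1)// (integral_image m23 gam2)//.
by have [_ ->] := integralD_quasi qU1g qU2g.
Qed.

Let b_le1 : \int[rho]_t (b t)%:E <= 1.
Proof.
rewrite -[leRHS](@probability_setT _ _ _ p1) -[leRHS]mul1e -integral_cst//.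
have := glue_density_integral1 geta hp1 hp2 (measurable_cst 1) (fun=> lee01).
by under [X in X = _]eq_integral do rewrite mul1e; move=> <-.
Qed.

Let a_le1 : \int[rho]_t (a t)%:E <= 1.
Proof.
rewrite -[leRHS](@probability_setT _ _ _ pi) -[leRHS]mul1e -integral_cst//.
have := split_density_integral mK1 mK2 K1_ge0 K2_ge0 kE qpi (measurable_cst 1).
under [X in _ -> X = _]eq_integral do rewrite mul1e.
move=> -> //; apply: ge0_le_integral => //.
- by move=> v _; rewrite mul1e lee_fin divr_ge0.
- apply: emeasurable_funM => //; apply/measurable_EFinP; apply: measurable_funM => //.
  exact: measurable_fun_inv.
- move=> v _; rewrite mul1e lee_fin.
  by have [->|k0] := eqVneq (k v) 0%R; rewrite ?mul0r// divff.
Qed.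

(** Gibbs' inequality under the law of density a, read on its marginals. *)
Lemma half_costs_le : has_density gam rho a ->
  \int[p1]_v U1 v + \int[p2]_v U2 v <= \int[pi]_v L v.
Proof.
move=> dgam; rewrite L_image U_image.
have mb : measurable_fun setT b by exact: measurable_glue_density geta hp1 hp2.
have b0 t : (0 <= b t)%R by exact: glue_density_ge0 geta hp1 hp2 t.
have bpos : {ae gam, forall t, (0 < b t)%R}.
  by apply: filterS pos => t [_ [? ? ?]]; rewrite /b /glue_density !mulr_gt0.
have [qd d0] := gibbs_inequality dgam mb b0 bpos b_le1.
have [qU _] := integralD_quasi qU1g qU2g.
have [[mUd _] Ud] := integralD_quasi qU qd.
rewrite (@ae_eq_integral _ _ _ gam _
  (fun t => U1 (proj13 t) + U2 (proj23 t) + (ln (a t) - ln (b t))%:E)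
  (fun t => L t.1))//.
- rewrite [leRHS]Ud leeDl//; apply: le_trans d0.
  by rewrite subrr.
- exact: measurableT_comp mL measurable_fst.
- apply: filterS ln_ab => t lnt _; rewrite lnt /L /U1 /U2 -!EFinD.
  by congr EFin; lra.
Qed.

(** Gibbs' inequality under the law of density b, read on its marginals. *)
Lemma half_costs_ge : has_density gam rho b -> quasi_integrable pi L ->
  \int[pi]_v L v <= \int[p1]_v U1 v + \int[p2]_v U2 v.
Proof.
move=> dgam qL; rewrite L_image U_image.
have ma : measurable_fun setT a.
  exact: (measurable_split_density mK1 mK2 K1_ge0 K2_ge0 kE qpi).
have a0 t : (0 <= a t)%R by exact: (split_density_ge0 K1_ge0 K2_ge0 kE qpi t).
have apos : {ae gam, forall t, (0 < a t)%R}.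
  apply: filterS pos => t [[? ? ? ?] _].
  by rewrite /a /split_density !mulr_gt0// invr_gt0.
have [qd d0] := gibbs_inequality dgam ma a0 apos a_le1.
have mT : measurable_fun setT (fst : X * Y * Z -> X * Y) by exact: measurable_fst.
have qLg := quasi_integrable_image mT gampi qL.
have [[mLd _] Ld] := integralD_quasi qLg qd.
have [[mU _] _] := integralD_quasi qU1g qU2g.
rewrite (@ae_eq_integral _ _ _ gam _ (fun t => L t.1 + (ln (b t) - ln (a t))%:E)
  (fun t => U1 (proj13 t) + U2 (proj23 t)))//.
- rewrite [leRHS]Ld leeDl//; apply: le_trans d0.
  by rewrite subrr.
- apply: filterS ln_ab => t lnt _; rewrite /L /U1 /U2 -!EFinD.
  by congr EFin; lra.
Qed.

End gibbs_of_plan.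

(** The law of density a exists because k is positive pi-almost everywhere, and
eta, p1, p2 are its images. Their densities come from the Radon-Nikodym
theorem, which avoids explicit formulas for the marginal densities. *)
Theorem plan_splitting (pi : probability (X * Y)%type R) (q : X * Y -> R) :
  has_density pi (tensor mu nu) q -> {ae pi, forall v, (0 < k v)%R} ->
  exists (eta : probability Z R) (g : Z -> R)
    (p1 : probability (X * Z)%type R) (f1 : X * Z -> R)
    (p2 : probability (Y * Z)%type R) (f2 : Y * Z -> R),
  [/\ has_density eta lam g, half_plan mu eta K1 p1 f1,
      half_plan nu eta K2 p2 f2,
      (forall A, measurable A -> p1 (fst @^-1` A) = pi (fst @^-1` A)) /\
      (forall A, measurable A -> p2 (fst @^-1` A) = pi (snd @^-1` A)) &
      quasi_integrable p1 (fun v => (half_cost K1 g f1 v)%:E) ->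
      quasi_integrable p2 (fun v => (half_cost K2 g f2 v)%:E) ->
      \int[p1]_v (half_cost K1 g f1 v)%:E + \int[p2]_v (half_cost K2 g f2 v)%:E <=
      \int[pi]_v (ln (q v) - ln (k v))%:E].
Proof.
move=> qpi kpi.
pose a := split_density K1 K2 k q.
have ma : measurable_fun setT a.
  exact: (measurable_split_density mK1 mK2 K1_ge0 K2_ge0 kE qpi).
have a0 t : (0 <= a t)%R by exact: (split_density_ge0 K1_ge0 K2_ge0 kE qpi t).
have aI (h : X * Y -> \bar R) : measurable_fun setT h -> (forall v, 0 <= h v) ->
    \int[rho]_t (h t.1 * (a t)%:E) = \int[pi]_v h v.
  move=> mh h0.
  rewrite (split_density_integral mK1 mK2 K1_ge0 K2_ge0 kE qpi)//.
  apply: ae_eq_integral => //.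
    apply: emeasurable_funM => //; apply/measurable_EFinP.
    by apply: measurable_funM => //; exact: measurable_fun_inv.
  by apply: filterS kpi => v kv _; rewrite divff ?gt_eqF// mule1.
have a1 : \int[rho]_t (a t)%:E = 1.
  have := aI (cst 1) (measurable_cst 1) (fun=> lee01).
  under [X in X = _]eq_integral do rewrite mul1e.
  by move=> ->; rewrite integral_cst//= mul1e probability_setT.
have [gam dgam] := probability_density_exists ma a0 a1.
have /null_content_dominatesP gamrho := density_dominates dgam.
have mfst : measurable_fun setT (fst : X * Y * Z -> X * Y) by exact: measurable_fst.
have msnd : measurable_fun setT (snd : X * Y * Z -> Z) by exact: measurable_snd.
have pm dS dT (S : measurableType dS) (T : measurableType dT) (f : S -> T) A :
    measurable_fun setT f -> measurable A -> measurable (f @^-1` A).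
  by move=> mf mA; rewrite -[X in measurable X]setTI; exact: mf.
have gampi := density_image mfst dgam aI.
have [eta etaE] := image_probability gam msnd.
have [p1 p1E] := image_probability gam m13.
have [p2 p2E] := image_probability gam m23.
have gam1 A : measurable A -> p1 A = gam (proj13 @^-1` A) by move=> _; exact: p1E.
have gam2 A : measurable A -> p2 A = gam (proj23 @^-1` A) by move=> _; exact: p2E.
have gam3 A : measurable A -> eta A = gam (snd @^-1` A) by move=> _; exact: etaE.
have [g geta] : exists g, has_density eta lam g.
  apply: dominates_density; apply/null_content_dominatesP => B mB B0.
  by apply: (etrans (etaE _)); apply: gamrho; [exact: pm|exact: rho3_null].
have e1 B : measurable B -> p1 (snd @^-1` B) = eta B.
  by move=> mB; rewrite p1E etaE.
have e2 B : measurable B -> p2 (snd @^-1` B) = eta B.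
  by move=> mB; rewrite p2E etaE.
have [f1 df1] : exists f1, has_density p1 (tensor mu eta) f1.
  apply: dominates_density; apply: half_plan_dominates => // E mE E0.
  by apply: (etrans (p1E _)); apply: gamrho; [exact: pm|exact: rho13_null].
have [f2 df2] : exists f2, has_density p2 (tensor nu eta) f2.
  apply: dominates_density; apply: half_plan_dominates => // E mE E0.
  by apply: (etrans (p2E _)); apply: gamrho; [exact: pm|exact: rho23_null].
have apos := density_gt0 dgam.
have posm dT (T : measurableType dT) (K : T -> R) :
    measurable_fun setT K -> measurable [set v | (0 < K v)%R].
  move=> mK; rewrite (_ : [set v | _] = K @^-1` `]0%R, +oo[); first exact: pm.
  by apply/seteqP; split => v; rewrite /= in_itv/= andbT.
have K1p : {ae p1, forall v, (0 < K1 v)%R}.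
  apply: (image_ae m13 gam1); first exact: posm.
  apply: filterS apos => t apos; rewrite lt_neqAle K1_ge0 andbT eq_sym.
  by apply/eqP => K0; move: apos; rewrite /a /split_density K0 mul0r mulr0 ltxx.
have K2p : {ae p2, forall v, (0 < K2 v)%R}.
  apply: (image_ae m23 gam2); first exact: posm.
  apply: filterS apos => t apos; rewrite lt_neqAle K2_ge0 andbT eq_sym.
  by apply/eqP => K0; move: apos; rewrite /a /split_density K0 !mulr0 ltxx.
have hp1 : half_plan mu eta K1 p1 f1 by [].
have hp2 : half_plan nu eta K2 p2 f2 by [].
exists eta, g, p1, f1, p2, f2; split => //.
- by split => A mA; [rewrite p1E gampi|rewrite p2E gampi] => //;
    exact: pm.
- move=> qU1 qU2.
  exact: (half_costs_le geta hp1 hp2 qpi kpi gampi gam1 gam2).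
Qed.

(** The law of density b has p1 and p2 as images. Its image pi charges only the
set where k is positive: where k(x, y) vanishes, K(x, z) K(y, z) vanishes
for almost every z, whereas p1 and p2 charge only positive values of K. *)
Theorem plan_gluing (eta : probability Z R) (g : Z -> R)
    (p1 : probability (X * Z)%type R) (f1 : X * Z -> R)
    (p2 : probability (Y * Z)%type R) (f2 : Y * Z -> R) :
  has_density eta lam g -> half_plan mu eta K1 p1 f1 ->
  half_plan nu eta K2 p2 f2 ->
  exists (pi : probability (X * Y)%type R) (q : X * Y -> R),
  [/\ has_density pi (tensor mu nu) q, {ae pi, forall v, (0 < k v)%R},
      (forall A, measurable A -> pi (fst @^-1` A) = p1 (fst @^-1` A)) /\
      (forall A, measurable A -> pi (snd @^-1` A) = p2 (fst @^-1` A)) &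
      quasi_integrable p1 (fun v => (half_cost K1 g f1 v)%:E) ->
      quasi_integrable p2 (fun v => (half_cost K2 g f2 v)%:E) ->
      quasi_integrable pi (fun v => (ln (q v) - ln (k v))%:E) ->
      \int[pi]_v (ln (q v) - ln (k v))%:E <=
      \int[p1]_v (half_cost K1 g f1 v)%:E + \int[p2]_v (half_cost K2 g f2 v)%:E].
Proof.
move=> geta hp1 hp2.
pose b := glue_density g f1 f2.
have mb : measurable_fun setT b by exact: (measurable_glue_density geta hp1 hp2).
have b0 t : (0 <= b t)%R by exact: (glue_density_ge0 geta hp1 hp2 t).
have bI1 := glue_density_integral1 geta hp1 hp2.
have bI2 := glue_density_integral2 geta hp1 hp2.
have b1 : \int[rho]_t (b t)%:E = 1.
  have := bI1 _ (measurable_cst 1) (fun=> lee01).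
  under [X in X = _]eq_integral do rewrite mul1e.
  by move=> ->; rewrite integral_cst//= mul1e probability_setT.
have [gam dgam] := probability_density_exists mb b0 b1.
have gamrho := density_dominates dgam.
have mfst : measurable_fun setT (fst : X * Y * Z -> X * Y) by exact: measurable_fst.
have gam1 := density_image m13 dgam bI1.
have gam2 := density_image m23 dgam bI2.
have [pi piE] := image_probability gam mfst.
have gampi A : measurable A -> pi A = gam (fst @^-1` A) by move=> _; exact: piE.
have [q qpi] : exists q, has_density pi (tensor mu nu) q.
  apply: dominates_density; apply/null_content_dominatesP => B mB B0.
  apply: (etrans (piE _)).
  move/null_content_dominatesP : gamrho; apply; last exact: rho12_null.
  by rewrite -[X in measurable X]setTI; exact: mfst.
have k0 : {ae rho, forall t : X * Y * Z,
    (\1_[set v | k v = 0%R] t.1 : R)%:E * (K1 (proj13 t) * K2 (proj23 t))%:E = 0}.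
  have mk0 : measurable [set v | k v = 0%R].
    rewrite (_ : [set v | _] = setT `&` k @^-1` [set 0%R]); last by rewrite setTI.
    exact: mk.
  have mKK : measurable_fun setT
    (fun t : X * Y * Z => (K1 (proj13 t) * K2 (proj23 t))%:E).
    by apply/measurable_EFinP/measurable_funM; exact: measurableT_comp.
  have m1KK : measurable_fun setT (fun t : X * Y * Z =>
    (\1_[set v | k v = 0%R] t.1 : R)%:E * (K1 (proj13 t) * K2 (proj23 t))%:E).
    apply: emeasurable_funM => //; apply/measurable_EFinP.
    by apply: measurableT_comp => //; exact: measurable_indic.
  have KK0 t : 0 <= (K1 (proj13 t) * K2 (proj23 t) : R)%:E :> \bar R.
    by rewrite lee_fin mulr_ge0.
  apply: ge0_integral_eq0_ae => //.
    by move=> t; rewrite mule_ge0// lee_fin.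
  rewrite tonelli1//; last by move=> t; rewrite mule_ge0// lee_fin.
  apply: integral0_eq => v _; rewrite /= ge0_integralZl//=.
  - rewrite -kE indicE; case: (boolP (v \in _)); rewrite ?mul0e//.
    by rewrite inE/= => ->; rewrite mule0.
  - exact: measurableT_comp mKK (pair1_measurable v).
have kpi : {ae pi, forall v, (0 < k v)%R}.
  apply: (image_ae mfst gampi).
    rewrite (_ : [set v | _] = k @^-1` `]0%R, +oo[).
      by rewrite -[X in measurable X]setTI; exact: mk.
    by apply/seteqP; split => v; rewrite /= in_itv/= andbT.
  have [_ _ K1p] := hp1; have [_ _ K2p] := hp2.
  have K1g := ae_image m13 gam1 K1p; have K2g := ae_image m23 gam2 K2p.
  apply: filterS3 K1g K2g (ae_dominates gamrho k0) => t K1t K2t.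
  rewrite lt_neqAle k_ge0 andbT eq_sym => kt; apply/eqP => kt0.
  move: kt; rewrite indicE mem_set// mul1e => /eqP.
  by rewrite eqe gt_eqF// mulr_gt0.
exists pi, q; split => //.
- by split => A mA; rewrite piE ?gam1 ?gam2//;
    rewrite -[X in measurable X]setTI; [exact: measurable_fst|exact: measurable_fst].
- move=> qU1 qU2 qL.
  exact: (half_costs_ge geta hp1 hp2 qpi kpi gampi gam1 gam2).
Qed.

End splitting_and_gluing_theorems.

(** * The soft cost as the logarithm of a kernel *)

Section soft_kernel.
Context dX dZ (X : measurableType dX) (Z : measurableType dZ) (R : realType).
Variables (psi : X -> Z -> \bar R) (lam : {finite_measure set Z -> \bar R}) (eps : R).
Hypotheses (psi_gtNy : forall x z, psi x z != -oo)
  (mpsi : measurable_fun setT (fun p : X * Z => psi p.1 p.2))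
  (eps_gt0 : (0 < eps)%R)
  (int_fin : forall x, \int[lam]_z expeR (- ((2 / eps)%:E * psi x z)) < +oo).

Definition gibbs_kernel (v : X * Z) : R :=
  fine (expeR (- (eps^-1%:E * psi v.1 v.2))).

Definition soft_kernel (v : X * X) : R :=
  fine (\int[lam]_z expeR (- (eps^-1%:E * (psi v.1 z + psi v.2 z)))).

Local Notation K := gibbs_kernel.
Local Notation k := soft_kernel.
Local Notation c := (soft_cost psi eps lam).

Lemma gibbs_kernel_ge0 v : (0 <= K v)%R.
Proof. by rewrite fine_ge0// expeR_ge0. Qed.

Lemma gibbs_kernelE v : (K v)%:E = expeR (- (eps^-1%:E * psi v.1 v.2)).
Proof.
rewrite fineK// ge0_fin_numE ?expeR_ge0// ltey expeR_eqy eqe_oppLR/=.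
have := psi_gtNy v.1 v.2; case: (psi v.1 v.2) => [r| |]//= _.
by rewrite gt0_muley// lte_fin invr_gt0.
Qed.

Lemma gibbs_kernel_gt0 v : (0 < K v)%R -> psi v.1 v.2 \is a fin_num.
Proof.
rewrite -lte_fin gibbs_kernelE => h; rewrite fin_numE psi_gtNy/=.
apply: contraTN h => /eqP ->.
by rewrite gt0_muley ?lte_fin ?invr_gt0//= ltxx.
Qed.

Lemma ln_gibbs_kernel v : (0 < K v)%R ->
  (ln (K v))%:E = - (eps^-1%:E * psi v.1 v.2).
Proof.
move=> /gibbs_kernel_gt0 fpsi; rewrite /K -(fineK fpsi)/=.
by rewrite expRK.
Qed.

Lemma measurable_gibbs_kernel : measurable_fun setT K.
Proof.
have -> : K = (fun v => if psi v.1 v.2 == +oo then 0%R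
    else expR (- (eps^-1 * fine (psi v.1 v.2)))%R).
  apply/funext => v; rewrite /K; have := psi_gtNy v.1 v.2.
  case: (psi v.1 v.2) => [r| |]//= _.
  by rewrite gt0_muley ?lte_fin ?invr_gt0.
apply: measurable_fun_ifT => //; first exact: measurable_fun_eqe.
apply: (measurableT_comp (@measurable_expR R)); apply: measurable_funN.
by apply: measurable_funM => //; exact: measurableT_comp.
Qed.

Lemma gibbs_kernelM x y z :
  (K (x, z) * K (y, z))%:E = expeR (- (eps^-1%:E * (psi x z + psi y z))).
Proof.
rewrite EFinM !gibbs_kernelE/= -expeRD; congr expeR.
have := psi_gtNy x z; have := psi_gtNy y z.
have e0 : (0 < eps^-1)%R by rewrite invr_gt0.
case: (psi x z) (psi y z) => [r| |] [s| |]//= _ _;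
  rewrite ?gt0_muley ?lte_fin//=.
by rewrite mulrDr opprD.
Qed.

(** K(x, z) K(y, z) is at most the sum of the squares, which the hypothesis on
lambda makes integrable. *)
Lemma soft_kernel_lty x y :
  \int[lam]_z expeR (- (eps^-1%:E * (psi x z + psi y z))) < +oo.
Proof.
have mK := measurable_gibbs_kernel.
have mKx u : measurable_fun setT (fun z => (K (u, z))%:E).
  by apply/measurable_EFinP; exact: (measurableT_comp mK (pair1_measurable u)).
have sq u z : (K (u, z))%:E * (K (u, z))%:E = expeR (- ((2 / eps)%:E * psi u z)).
  rewrite -EFinM gibbs_kernelM; congr expeR; congr (- _).
  have := psi_gtNy u z; case: (psi u z) => [r| |]//= _.
    by congr EFin; field; rewrite gt_eqF.
  by rewrite !gt0_muley// lte_fin ?divr_gt0// invr_gt0.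
have m2 u : measurable_fun setT (fun z => expeR (- ((2 / eps)%:E * psi u z))).
  by under eq_fun do rewrite -sq; exact: emeasurable_funM.
apply: (@le_lt_trans _ _ (\int[lam]_z (expeR (- ((2 / eps)%:E * psi x z)) +
    expeR (- ((2 / eps)%:E * psi y z))))).
  apply: ge0_le_integral => //.
  - by move=> z _; exact: expeR_ge0.
  - under eq_fun do rewrite -gibbs_kernelM EFinM.
    exact: emeasurable_funM.
  - exact: emeasurable_funD.
  - move=> z _; rewrite -gibbs_kernelM -!sq -!EFinM -EFinD lee_fin.
    have := gibbs_kernel_ge0 (x, z); have := gibbs_kernel_ge0 (y, z).
    by nra.
rewrite ge0_integralD//; [|by move=> z _; exact: expeR_ge0..].
by rewrite lte_add_pinfty.
Qed.

Lemma soft_kernelE v :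
  (k v)%:E = \int[lam]_z (K (v.1, z) * K (v.2, z))%:E.
Proof.
rewrite fineK; last first.
  rewrite ge0_fin_numE; first exact: soft_kernel_lty.
  by apply: integral_ge0 => z _; exact: expeR_ge0.
by apply: eq_integral => z _; rewrite gibbs_kernelM.
Qed.

Let mK := measurable_gibbs_kernel.
Let K0 := gibbs_kernel_ge0.

Lemma soft_kernel_ge0 v : (0 <= k v)%R.
Proof. exact: (kernel_ge0 K0 K0 soft_kernelE). Qed.

Lemma measurable_soft_kernel : measurable_fun setT k.
Proof. exact: (measurable_kernel mK mK K0 K0 soft_kernelE). Qed.

Let mk := measurable_soft_kernel.
Let k0 := soft_kernel_ge0.

Lemma soft_costE x y : c x y = - (eps%:E * lne (k (x, y))%:E).
Proof.
rewrite /soft_cost /k fineK//= ge0_fin_numE; first exact: soft_kernel_lty.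
by apply: integral_ge0 => z _; exact: expeR_ge0.
Qed.

Lemma measurable_soft_cost : measurable_fun setT (fun v : X * X => c v.1 v.2).
Proof.
under eq_fun do rewrite soft_costE -surjective_pairing.
apply: measurableT_comp => //; apply: measurable_funeM.
by apply: measurable_fun_lne; exact/measurable_EFinP.
Qed.

Lemma soft_cost_ln v : (0 < k v)%R -> c v.1 v.2 = (- (eps * ln (k v)))%:E.
Proof. by move=> kv; rewrite soft_costE -surjective_pairing lne_EFin. Qed.

Lemma soft_cost_lty v : c v.1 v.2 < +oo -> (0 < k v)%R.
Proof.
rewrite soft_costE -surjective_pairing/=; case: ifPn; last by rewrite -ltNge.
by rewrite gt0_muleNy ?lte_fin.
Qed.

Lemma soft_costC x y : c x y = c y x.
Proof.
rewrite /soft_cost; congr (- (_ * lne _)); apply: eq_integral => z _.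
by rewrite addeC.
Qed.

Section value.
Variables (mu nu : {finite_measure set X -> \bar R}).
Variables (pi : probability (X * X)%type R) (q : X * X -> R).
Hypotheses (qpi : has_density pi (tensor mu nu) q)
  (wpi : integral_well_defined c pi).

Lemma quasi_integrable_soft_cost : quasi_integrable pi (fun v => c v.1 v.2).
Proof. by split => //; exact: measurable_soft_cost. Qed.

Let qln := quasi_integrable_ln_density qpi.

Lemma soft_kernel_ae_gt0 : \int[pi]_v c v.1 v.2 < +oo ->
  {ae pi, forall v, (0 < k v)%R}.
Proof.
move=> /(quasi_integrable_ae_lty quasi_integrable_soft_cost).
by apply: filterS => v; exact: soft_cost_lty.
Qed.

(** For a finite cost, the objective of entropic transport is a single integral. *)
Lemma soft_cost_value : {ae pi, forall v, (0 < k v)%R} ->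
  quasi_integrable pi (fun v => (ln (q v) - ln (k v))%:E) /\
  \int[pi]_v c v.1 v.2 + eps%:E * KL pi (tensor mu nu) =
  eps%:E * \int[pi]_v (ln (q v) - ln (k v))%:E.
Proof.
move=> kpi; have qc := quasi_integrable_soft_cost.
have [qel el] := integralZ_quasi (ltW eps_gt0) qln.
have [[mcl qcl] cl] := integralD_quasi qc qel.
have [mq _ _] := qpi.
have mL : measurable_fun setT (fun v => (ln (q v) - ln (k v))%:E).
  by apply/measurable_EFinP; apply: measurable_funB; exact: measurable_fun_ln.
have LE : {ae pi, forall v, c v.1 v.2 + eps%:E * (ln (q v))%:E =
    eps%:E * (ln (q v) - ln (k v))%:E}.
  apply: filterS kpi => v kv; rewrite soft_cost_ln//.
  by rewrite -!EFinM -EFinD mulrBr addrC.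
have qL : quasi_integrable pi (fun v => (ln (q v) - ln (k v))%:E).
  have ie0 : (0 <= eps^-1)%R by rewrite invr_ge0 ltW.
  have [qc' _] := integralZ_quasi ie0 (conj mcl qcl).
  apply: quasi_integrable_ae_ge mL qc' _; apply: filterS LE => v ->.
  by rewrite -!EFinM mulrA mulVf ?gt_eqF// mul1r.
split=> //; rewrite (KL_density qpi) -el -cl.
have [[mL' _] <-] := integralZ_quasi (ltW eps_gt0) qL.
by apply: ae_eq_integral => //; apply: filterS LE => v -> _.
Qed.

End value.

End soft_kernel.

(** * Half costs: their value and their integrability *)

Section half_plan_values.
Context dX dZ (X : measurableType dX) (Z : measurableType dZ) (R : realType).
Variables (psi : X -> Z -> \bar R) (lam : {finite_measure set Z -> \bar R}) (eps : R).
Hypotheses (psi_gtNy : forall x z, psi x z != -oo)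
  (mpsi : measurable_fun setT (fun p : X * Z => psi p.1 p.2))
  (eps_gt0 : (0 < eps)%R)
  (int_fin : forall x, \int[lam]_z expeR (- ((2 / eps)%:E * psi x z)) < +oo).

Local Notation K := (gibbs_kernel psi eps).
Local Notation k := (soft_kernel psi lam eps).
Local Notation c := (soft_cost psi eps lam).

Let mK := measurable_gibbs_kernel psi_gtNy mpsi eps_gt0.
Let K0 := gibbs_kernel_ge0 psi eps.
Let kE := soft_kernelE psi_gtNy mpsi eps_gt0 int_fin.
Let mk := measurable_soft_kernel psi_gtNy mpsi eps_gt0 int_fin.
Let k0 := soft_kernel_ge0 psi_gtNy mpsi eps_gt0 int_fin.

Variables (mu : {finite_measure set X -> \bar R}) (eta : probability Z R) (g : Z -> R).
Variables (p : probability (X * Z)%type R) (f : X * Z -> R).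
Hypotheses (geta : has_density eta lam g) (hp : half_plan mu eta K p f).

Let mH : measurable_fun setT (fun v => (half_cost K g f v)%:E).
Proof.
have [mg _ _] := geta; have [[mf _ _] _ _] := hp.
by apply/measurable_EFinP; exact: (measurable_half_cost mK mg mf).
Qed.

Lemma half_plan_marginal2 (h : Z -> \bar R) : measurable_fun setT h ->
  \int[p]_v h v.2 = \int[eta]_z h z.
Proof.
move=> mh; have [_ e2 _] := hp.
rewrite (@integral_image _ _ _ _ _ snd measurable_snd p eta)// => B mB.
by apply/esym; exact: e2.
Qed.

(** The term (ln g) / 2 contributes half of the entropy of eta, so that two half
plans over eta account for it exactly once. *)
Lemma half_cost_value : integral_well_defined psi p ->
  quasi_integrable p (fun v => (half_cost K g f v)%:E) /\
  eps%:E * \int[p]_v (half_cost K g f v)%:E =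
  \int[p]_v psi v.1 v.2 + eps%:E * KL p (tensor mu eta) +
  (2^-1)%:E * (eps%:E * KL eta lam).
Proof.
move=> wpsi; have [df e2 Kp] := hp; have [mg g0 _] := geta.
have qpsi : quasi_integrable p (fun v => psi v.1 v.2) by split.
have [qf ef] := integralZ_quasi (ltW eps_gt0) (quasi_integrable_ln_density df).
have qg : quasi_integrable p (fun v => (ln (g v.2))%:E).
  apply: (@quasi_integrable_image _ _ _ _ _ snd measurable_snd p eta
    (fun z => (ln (g z))%:E)).
    by move=> B mB; apply/esym; exact: e2.
  exact: quasi_integrable_ln_density geta.
have [qeg eg] := integralZ_quasi (ltW eps_gt0) qg.
have half0 : (0 <= 2^-1 :> R)%R by rewrite invr_ge0.
have [qheg heg] := integralZ_quasi half0 qeg.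
have [qpf epf] := integralD_quasi qpsi qf.
have [[mt tN] et] := integralD_quasi qpf qheg.
have tE : {ae p, forall v, psi v.1 v.2 + eps%:E * (ln (f v))%:E +
    (2^-1)%:E * (eps%:E * (ln (g v.2))%:E) = eps%:E * (half_cost K g f v)%:E}.
  apply: filterS Kp => v Kv; rewrite /half_cost EFinB ln_gibbs_kernel//.
  rewrite -(fineK (gibbs_kernel_gt0 psi_gtNy eps_gt0 Kv)) /=.
  by congr EFin; field; rewrite gt_eqF.
have qH : quasi_integrable p (fun v => (half_cost K g f v)%:E).
  have ie0 : (0 <= eps^-1)%R by rewrite invr_ge0 ltW.
  have [qc' _] := integralZ_quasi ie0 (conj mt tN).
  apply: quasi_integrable_ae_ge mH qc' _; apply: filterS tE => v ->.
  by rewrite -!EFinM mulrA mulVf ?gt_eqF// mul1r.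
split => //; have [[mH' _] <-] := integralZ_quasi (ltW eps_gt0) qH.
rewrite (KL_density df) (KL_density geta) -half_plan_marginal2; last first.
  by apply/measurable_EFinP; exact: measurable_fun_ln.
rewrite -eg -heg -ef -epf -et.
by apply: ae_eq_integral => //; apply: filterS tE => v -> _.
Qed.

Hypothesis wdiag : forall D : probability (X * X)%type R,
  (forall A, measurable A -> D (fst @^-1` A) = p (fst @^-1` A)) ->
  (forall A, measurable A -> D (snd @^-1` A) = p (fst @^-1` A)) ->
  integral_well_defined c D.

Let m (x : X) : R := Num.max 1%R (k (x, x)).

Let mdiag : measurable_fun setT (fun x : X => (x, x)).
Proof. exact: measurable_fun_pair. Qed.

Let mm : measurable_fun setT m.
Proof. by apply: measurable_maxr => //; exact: (measurableT_comp mk mdiag). Qed.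

Let m_ge1 x : (1 <= m x)%R.
Proof. by rewrite le_max lexx. Qed.

Let m_gt0 x : (0 < m x)%R.
Proof. exact: lt_le_trans ltr01 (m_ge1 x). Qed.

Let lnm x : (ln (m x))%:E = eps^-1%:E * maxe (- c x x) 0.
Proof.
have -> : - c x x = eps%:E * lne (k (x, x))%:E.
  by rewrite (soft_costE psi_gtNy mpsi eps_gt0 int_fin); exact: oppeK.
rewrite /m.
have [kx|kx] := ltP 0%R (k (x, x)); last first.
  rewrite le0_lneNy ?lee_fin// gt0_muleNy ?lte_fin// maxNye mule0.
  by rewrite max_l ?ln1// (le_trans kx).
rewrite lne_EFin//; have [k1|k1] := leP 1%R (k (x, x)).
  rewrite max_l; last by rewrite -EFinM lee_fin mulr_ge0 ?ln_ge0// ltW.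
  by rewrite -!EFinM mulrA mulVf ?gt_eqF// mul1r.
rewrite max_r ?mule0 ?ln1// -EFinM lee_fin mulr_ge0_le0 ?(ltW eps_gt0)//.
by rewrite ln_le0// ltW.
Qed.

(** The negative part of - ln m(x) is c_eps(x, x)^- / eps, whose integral is that
of the negative part of the cost under the diagonal coupling of the first
marginal of p with itself. *)
Let qlnm : quasi_integrable p (fun v => (- ln (m v.1))%:E).
Proof.
have mlnm : measurable_fun setT (fun v : X * Z => (ln (m v.1))%:E).
  apply/measurable_EFinP; apply: measurable_fun_ln.
  exact: (measurableT_comp mm measurable_fst).
split.
  by under eq_fun do rewrite EFinN; exact: measurableT_comp.
have mphi : measurable_fun setT (fun v : X * Z => (v.1, v.1)).
  by apply: measurable_fun_pair; exact: measurable_fst.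
have [D DE] := image_probability p mphi.
have /wdiag wD : forall A, measurable A -> D (fst @^-1` A) = p (fst @^-1` A).
  by move=> A _; rewrite DE.
have {}wD : integral_well_defined c D by apply: wD => A _; rewrite DE.
have mc := measurable_soft_cost psi_gtNy mpsi eps_gt0 int_fin.
have DE' A : measurable A -> D A = p ((fun v => (v.1, v.1)) @^-1` A).
  by move=> _; exact: DE.
move: wD; rewrite /integral_well_defined (ge0_integral_image mphi DE')//; last first.
  exact: measurable_funeneg.
move=> /(lte_mul_pinfty _ _) h.
have -> : \int[p]_v (fun v => (- ln (m v.1))%:E)^\- v =
    \int[p]_v (eps^-1%:E * (fun q : X * X => c q.1 q.2)^\- (v.1, v.1)).
  apply: eq_integral => v _; rewrite !funenegE -lnm /= opprK max_l//.
  by rewrite lee_fin ln_ge0.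
rewrite ge0_integralZl_EFin// ?invr_ge0 ?(ltW eps_gt0)//.
- by apply: h; rewrite // lee_fin invr_ge0 ltW.
- by apply: measurableT_comp mphi; exact: measurable_funeneg.
Qed.

Let w (v : X * Z) : R := (K v / (m v.1 * f v * Num.sqrt (g v.2)))%R.

Let msg : measurable_fun setT (fun v : X * Z => Num.sqrt (g v.2)).
Proof.
have [mg _ _] := geta.
by apply: measurable_fun_sqrt; exact: (measurableT_comp mg measurable_snd).
Qed.

Let mm1 : measurable_fun setT (fun v : X * Z => m v.1).
Proof. exact: (measurableT_comp mm measurable_fst). Qed.

Let mw : measurable_fun setT w.
Proof.
have [[mf f0 _] _ _] := hp.
apply: measurable_funM => //; apply: measurable_fun_inv.
  by move=> v; rewrite !mulr_ge0// ?sqrtr_ge0// ltW.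
by apply: measurable_funM => //; exact: measurable_funM.
Qed.

(** With respect to mu (x) lambda the integrand is at most K sqrt(g) / m, and
K sqrt(g) / m <= (K^2 / m + g) / 2 because m >= 1. Integrated in z this is at
most (k(x, x) / m(x) + 1) / 2, hence at most 1. *)
Let wint : \int[p]_v (w v)%:E <= mu setT.
Proof.
have [df e2 Kp] := hp; have [mg g0 _] := geta; have [mf f0 _] := df.
pose W v := (K v / (m v.1 * Num.sqrt (g v.2)))%R.
have W0 v : (0 <= W v)%R by rewrite divr_ge0// mulr_ge0 ?sqrtr_ge0// ltW.
have w0 v : (0 <= w v)%R by rewrite divr_ge0// !mulr_ge0 ?sqrtr_ge0// ltW.
have mW : measurable_fun setT (fun v => (W v)%:E).
  apply/measurable_EFinP; apply: measurable_funM => //; apply: measurable_fun_inv.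
    by move=> v; rewrite !mulr_ge0// ?sqrtr_ge0// ltW.
  exact: measurable_funM.
have mwE : measurable_fun setT (fun v => (w v)%:E) by exact/measurable_EFinP.
rewrite (ge0_integral_density df)//.
apply: (@le_trans _ _ (\int[tensor mu eta]_v (W v)%:E)).
  apply: ge0_le_integral => //.
  - by move=> v _; rewrite -EFinM lee_fin mulr_ge0.
  - by apply: emeasurable_funM => //; exact/measurable_EFinP.
  - move=> v _; rewrite -EFinM lee_fin /w /W.
    have [->|fn0] := eqVneq (f v) 0%R.
      by rewrite mulr0 divr_ge0// mulr_ge0 ?sqrtr_ge0// ltW.
    rewrite !invfM (_ : K v * _ * _ =
      K v * ((m v.1)^-1 * (Num.sqrt (g v.2))^-1) * ((f v)^-1 * f v))%R; last by ring.
    by rewrite mulVf// mulr1.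
rewrite tonelli1//.
rewrite -[leRHS]mul1e -integral_cst//.
have mWx x : measurable_fun setT (fun z => (W (x, z))%:E).
  exact: (measurableT_comp mW (pair1_measurable x)).
have mKx x : measurable_fun setT (fun z => K (x, z)).
  exact: (measurableT_comp mK (pair1_measurable x)).
apply: ge0_le_integral => //.
- by move=> x _; apply: integral_ge0 => z _; rewrite lee_fin.
- by apply: (measurable_integral2 eta mW) => v; rewrite lee_fin.
move=> x _; rewrite (ge0_integral_density geta)//; last first.
  by move=> z; rewrite lee_fin.
pose A z := ((2 * m x)^-1 * (K (x, z) * K (x, z)) + 2^-1 * g z)%R.
have mA1 : measurable_fun setT (fun z => (K (x, z) * K (x, z))%:E).
  by apply/measurable_EFinP; exact: measurable_funM.
have mg1 : measurable_fun setT (fun z => (g z)%:E) by exact/measurable_EFinP.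
have imx0 : (0 <= (2 * m x)^-1)%R by rewrite invr_ge0 mulr_ge0// ltW.
apply: (@le_trans _ _ (\int[lam]_z ((2 * m x)^-1%:E * (K (x, z) * K (x, z))%:E +
    (2^-1)%:E * (g z)%:E))).
  apply: ge0_le_integral => //.
  - by move=> z _; rewrite -EFinM lee_fin mulr_ge0.
  - exact: emeasurable_funM.
  - by apply: emeasurable_funD; exact: measurable_funeM.
  - move=> z _; rewrite -!EFinM -EFinD lee_fin /W/=.
    (* where g vanishes, W is a quotient by 0, hence 0 *)
    have [->|gn0] := eqVneq (g z) 0%R.
      by rewrite sqrtr0 !mulr0 addr0 mulr_ge0// mulr_ge0.
    have gz : (0 < g z)%R by rewrite lt_neqAle eq_sym gn0/=.
    set s := Num.sqrt (g z).
    have sg : (0 < s)%R by rewrite sqrtr_gt0.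
    have -> : g z = (s * s)%R by rewrite -expr2 sqr_sqrtr// ltW.
    have mx := m_ge1 x; have mx0 := m_gt0 x; have Kx := K0 (x, z).
    rewrite (_ : K (x, z) / (m x * s) * (s * s) = (m x)^-1 * (K (x, z) * s))%R; last first.
      by field; rewrite !gt_eqF.
    rewrite (_ : (2 * m x)^-1 * (K (x, z) * K (x, z)) + 2^-1 * (s * s) =
      (m x)^-1 * (2^-1 * (K (x, z) * K (x, z) + m x * (s * s))))%R; last first.
      by field; rewrite gt_eqF.
    rewrite ler_pM2l ?invr_gt0//.
    have : (0 <= (K (x, z) - s) ^+ 2)%R by exact: sqr_ge0.
    have : (s * s <= m x * (s * s))%R by rewrite ler_peMl// mulr_ge0// ltW.
    by rewrite expr2; lra.
rewrite ge0_integralD//; last 4 first.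
- by move=> z _; rewrite -EFinM lee_fin mulr_ge0// mulr_ge0.
- exact: measurable_funeM.
- by move=> z _; rewrite -EFinM lee_fin mulr_ge0.
- exact: measurable_funeM.
rewrite ge0_integralZl_EFin//; last by move=> z _; rewrite lee_fin mulr_ge0.
rewrite ge0_integralZl_EFin//; last by move=> z _; rewrite lee_fin.
rewrite -(kE (x, x)).
have -> : \int[lam]_z (g z)%:E = 1.
  by have [_ _ gE] := geta; rewrite -gE//; exact: probability_setT.
rewrite mule1 -EFinM -EFinD lee_fin.
have : (k (x, x) <= m x)%R by rewrite le_max lexx orbT.
move=> km; rewrite invfM -mulrA (mulrC (m x)^-1)%R.
have : (k (x, x) / m x <= 1)%R by rewrite ler_pdivrMr// mul1r.
lra.
Qed.

(** The half cost is - ln w - ln m, with w = K / (m f sqrt(g)). The weight m(x),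
the maximum of 1 and k(x, x), is chosen so that w has a finite integral while
ln m is controlled by the cost on the diagonal. *)
Lemma quasi_integrable_half_cost :
  quasi_integrable p (fun v => (half_cost K g f v)%:E).
Proof.
have [df e2 Kp] := hp; have [mg g0 _] := geta.
have gpos : {ae p, forall v, (0 < g v.2)%R}.
  apply: (@ae_image _ _ _ _ _ snd measurable_snd p eta (fun z => 0 < g z)%R).
    by move=> B mB; apply/esym; exact: e2.
  exact: density_gt0 geta.
have fpos := density_gt0 df.
have wpos : {ae p, forall v, (0 < w v)%R}.
  apply: filterS3 Kp gpos fpos => v Kv gv fv.
  by rewrite /w divr_gt0// !mulr_gt0// sqrtr_gt0.
have wint' : \int[p]_v (w v)%:E <= (fine (mu setT))%:E.
  by rewrite fineK ?fin_num_measure.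
have [qw _] := quasi_integrable_oppln mw wpos wint'.
have [qwm _] := integralD_quasi qw qlnm.
apply: quasi_integrable_ae_ge mH qwm _.
apply: filterS3 Kp gpos fpos => v Kv gv fv.
rewrite -EFinD lee_fin /half_cost /w.
have -> : ln (g v.2) = (ln (Num.sqrt (g v.2)) *+ 2)%R.
  rewrite mulr2n -lnM ?posrE ?sqrtr_gt0// -expr2 sqr_sqrtr// ltW//.
have sg : (0 < Num.sqrt (g v.2))%R by rewrite sqrtr_gt0.
rewrite !lnM ?lnV ?lnM ?posrE ?invr_gt0 ?mulr_gt0//.
lra.
Qed.

End half_plan_values.

(** * Inequalities between infima *)

Section infimum_arithmetic.
Context (R : realType).
Implicit Types (S : set (\bar R)) (A B k L : \bar R).

(** Debiasedness of an infimum follows from doubling: each finite value v of the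
objective of (mu, nu) must dominate half the sum of the other two infima. The
convention oo - oo = +oo covers the case of an infinite infimum. *)
Lemma debiased_inf S A B : A != -oo -> B != -oo -> ereal_inf S != -oo ->
  (forall v, S v -> v < +oo -> A + B <= 2%:E * v) ->
  (0 <= ereal_inf S - 2^-1%:E * A - 2^-1%:E * B)%dE.
Proof.
move=> ANy BNy SNy H.
have half0 : (0 < 2^-1 :> R)%R by rewrite invr_gt0.
have AB : 2^-1%:E * (A + B) <= ereal_inf S.
  apply: le_ereal_inf_tmp => v Sv.
  have [vy|] := ltP v +oo; last by rewrite leye_eq => /eqP ->; exact: leey.
  have := lee_wpmul2l (ltW half0 : 0 <= 2^-1%:E) (H v Sv vy).
  by rewrite muleA -EFinM mulVf// mul1e.
move: (ereal_inf S) AB SNy => [r| |]//=; move: A B ANy BNy {H} => [a| |] [b| |]//= _ _;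
  rewrite ?gt0_muley ?lte_fin//.
- rewrite -EFinD -EFinM lee_fin => h _.
  change (0 <= (r - 2^-1 * a - 2^-1 * b)%:E).
  by rewrite lee_fin; lra.
all: by move=> _ _; exact: leey.
Qed.

(** The infima in a sum can be approached separately. *)
Lemma le_inf_add S1 S2 L k : ereal_inf S1 != -oo -> ereal_inf S2 != -oo ->
  k != -oo -> (forall a b, S1 a -> S2 b -> L <= a + b + k) ->
  L <= ereal_inf S1 + ereal_inf S2 + k.
Proof.
move=> S1Ny S2Ny kNy H.
have [ky|kfin] := eqVneq k +oo.
  rewrite ky addey ?leey//; move: S1Ny S2Ny.
  by case: (ereal_inf S1) (ereal_inf S2) => [r| |] [t| |].
have [S1y|S1fin] := eqVneq (ereal_inf S1) +oo.
  by rewrite S1y !addye ?leey.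
have [S2y|S2fin] := eqVneq (ereal_inf S2) +oo.
  by rewrite S2y addey// addye ?leey.
have f1 : ereal_inf S1 \is a fin_num by rewrite fin_numE S1Ny.
have f2 : ereal_inf S2 \is a fin_num by rewrite fin_numE S2Ny.
apply/lee_addgt0Pr => e e0.
have e2 : (0 < e / 2)%R by rewrite divr_gt0.
have [a Sa ha] := lb_ereal_inf_adherent e2 f1.
have [b Sb hb] := lb_ereal_inf_adherent e2 f2.
apply: (le_trans (H a b Sa Sb)).
have -> : ereal_inf S1 + ereal_inf S2 + k + e%:E =
    (ereal_inf S1 + (e / 2)%:E) + (ereal_inf S2 + (e / 2)%:E) + k.
  case: (ereal_inf S1) (ereal_inf S2) k {S1Ny S2Ny kNy H kfin S1fin S2fin f1 f2 ha hb}
    => [r| |] [t| |] [u| |] //=.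
  by congr EFin; field.
by rewrite leeD2r// leeD// ltW.
Qed.

End infimum_arithmetic.

(** * Csiszar divergences, and exchange of the two marginals *)

Section csiszar_extensional.
Context (R : realType) d (T : measurableType d).
Implicit Types mu nu : {finite_measure set T -> \bar R}.

(** Outside a common nu-null set the singular parts vanish, and on it the
absolutely continuous parts do. *)
Lemma lebesgue_decomposition_unique mu mu' nu f f' (s s' : {measure set T -> \bar R}) :
  (forall A, measurable A -> mu A = mu' A) ->
  lebesgue_decomposition mu nu f s -> lebesgue_decomposition mu' nu f' s' ->
  {ae nu, forall x, f x = f' x} /\ s setT = s' setT.
Proof.
move=> mumu' [mf f0 [N [mN nuN sN]] muE] [mf' f0' [N' [mN' nuN' sN']] muE'].
pose M := N `|` N'.
have mM : measurable M by exact: measurableU.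
have nuM : nu M = 0.
  apply/negligibleP => //; apply: negligibleU; exact/negligibleP.
have sM (t : {measure set T -> \bar R}) (P : set T) A : measurable P -> P `<=` M ->
    t (~` P) = 0 -> measurable A -> t A = t (A `&` M).
  move=> mP PM tP mA; rewrite -{1}(setIT A) -(setUv M) setIUr measureU//; last 3 first.
  - exact: measurableI.
  - by apply: measurableI => //; exact: measurableC.
  - by rewrite setIACA setICr setI0.
  suff t0 : t (A `&` ~` M) = 0 by rewrite [X in _ + X]t0 adde0.
  apply/eqP; rewrite eq_le measure_ge0 andbT -tP le_measure ?inE//.
  - by apply: measurableI => //; exact: measurableC.
  - exact: measurableC.
  - by move=> x [_ nMx] Px; apply: nMx; exact: PM.
have int0 (h : T -> R) A : measurable_fun setT h -> measurable A ->
    \int[nu]_(x in A `&` M) (h x)%:E = 0.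
  move=> mh mA; apply: null_set_integral; first exact: measurableI.
  - by apply/measurable_EFinP; exact: measurable_funTS.
  - apply/eqP; rewrite eq_le measure_ge0 andbT -nuM le_measure ?inE//.
    exact: measurableI.
have ss' A : measurable A -> s A = s' A.
  move=> mA; have mAM : measurable (A `&` M) by exact: measurableI.
  rewrite (sM s N)//; last exact: subsetUl.
  rewrite (sM s' N')//; last exact: subsetUr.
  have := muE _ mAM; rewrite int0// add0e => <-.
  by have := muE' _ mAM; rewrite int0// add0e => <-; exact: mumu'.
split; last exact: ss'.
have sfin A : measurable A -> s A \is a fin_num.
  move=> mA; rewrite ge0_fin_numE//.
  apply: (@le_lt_trans _ _ (mu A)); last by rewrite -ge0_fin_numE// fin_num_measure.
  by rewrite muE// leeDr//; apply: integral_ge0 => x _; rewrite lee_fin.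
have : ae_eq nu setT (EFin \o f) (EFin \o f').
  apply: integral_ae_eq => //.
  - apply/integrableP; split; first exact/measurable_EFinP.
    under eq_integral do rewrite /= ger0_norm//.
    apply: (@le_lt_trans _ _ (mu setT)); last by rewrite -ge0_fin_numE// fin_num_measure.
    by rewrite muE// leeDl.
  - exact/measurable_EFinP.
  - move=> A _ mA; have sA := sfin _ mA.
    rewrite -[LHS](@addeK _ (s A))// -[RHS](@addeK _ (s A))//; congr (_ - _).
    transitivity (mu A); first by rewrite muE.
    by rewrite mumu'// muE'// ss'.
by apply: filterS => x /(_ I) [].
Qed.

(** The measures mu and mu' may differ as functions on nonmeasurable sets, so the
equality does not come from substitution. *)
Lemma csiszar_eq (h : R -> \bar R) mu mu' nu : csiszar_entropy h ->
  (forall A, measurable A -> mu A = mu' A) -> csiszar h mu nu = csiszar h mu' nu.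
Proof.
move=> [_ _ _ lsc] mumu'; rewrite /csiszar /ac_density /singular_part.
case: cid => -[f s] /= D; case: cid => -[f' s'] /= D'.
have [ff' ss'] := lebesgue_decomposition_unique mumu' D D'.
have [mf f0 _ _] := D; have [mf' f0' _ _] := D'.
have mh (g : T -> R) : measurable_fun setT g -> (forall x, (0 <= g x)%R) ->
    measurable_fun setT (fun x : T => h (g x)).
  move=> mg g0.
  have -> : (fun x => h (g x)) = (patch (cst +oo) [set r | (0 <= r)%R] h) \o g.
    by apply/funext => x; rewrite /= /patch mem_set//=; exact: g0.
  by apply: measurableT_comp mg; exact: lower_semicontinuous_measurable.
rewrite ss'; congr (_ + _); apply: ae_eq_integral; rewrite //; [exact: mh|exact: mh|].
by apply: filterS ff' => x -> _.
Qed.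

End csiszar_extensional.

Section swap.
Context (R : realType) d1 d2 (X : measurableType d1) (Y : measurableType d2).
Variables (mu : {finite_measure set X -> \bar R}) (nu : {finite_measure set Y -> \bar R}).

Lemma density_swap (pi : probability (X * Y)%type R) (q : X * Y -> R) :
  has_density pi (tensor mu nu) q ->
  exists pi' : probability (Y * X)%type R,
    (forall A, pi' A = pi ((fun v => (v.2, v.1)) @^-1` A)) /\
    KL pi' (tensor nu mu) = KL pi (tensor mu nu).
Proof.
move=> qpi; have [mq q0 qE] := qpi.
have ms : measurable_fun setT (fun v : X * Y => (v.2, v.1)).
  by apply: measurable_fun_pair; [exact: measurable_snd|exact: measurable_fst].
have ms' : measurable_fun setT (fun v : Y * X => (v.2, v.1)).
  by apply: measurable_fun_pair; [exact: measurable_snd|exact: measurable_fst].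
have [pi' piE] := image_probability pi ms; exists pi'; split => //.
pose q' (v : Y * X) := q (v.2, v.1).
have mq' : measurable_fun setT q' by exact: (measurableT_comp mq ms').
have qpi' : has_density pi' (tensor nu mu) q'.
  split=> [//|v|A mA]; first exact: q0.
  rewrite integral_mkcond tonelli2; last 2 first.
  - by apply/(measurable_restrictT _ mA); apply/measurable_EFinP; exact: measurable_funTS.
  - by move=> v; apply: erestrict_ge0 => ? _; rewrite lee_fin; exact: q0.
  have mA' : measurable ((fun v : X * Y => (v.2, v.1)) @^-1` A).
    by rewrite -[X in measurable X]setTI; exact: ms.
  apply: (etrans (piE A)); apply: (etrans (qE _ mA')).
  rewrite integral_mkcond tonelli1.
  - apply: eq_integral => x _; apply: eq_integral => y _; rewrite !patchE.
    have [Ayx|nA] := pselect (A (y, x)).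
      by rewrite !mem_set.
    by rewrite !memNset.
  - by apply/(measurable_restrictT _ mA'); apply/measurable_EFinP; exact: measurable_funTS.
  - by move=> v; apply: erestrict_ge0 => ? _; rewrite lee_fin.
rewrite (KL_density qpi) (KL_density qpi').
have piE' A : measurable A -> pi' A = pi ((fun v => (v.2, v.1)) @^-1` A).
  by move=> _; exact: piE.
rewrite (integral_image ms piE').
  by apply: eq_integral => -[x y] _.
by apply/measurable_EFinP; exact: measurable_fun_ln.
Qed.

End swap.

(** * Splitting and regluing a plan of finite cost *)

Section finiteness.
Context (R : realType).

Lemma adde_ltyP (a b : \bar R) : a != -oo -> b != -oo -> a + b < +oo ->
  a < +oo /\ b < +oo.
Proof. by case: a b => [r| |] [s| |]//= _ _ _; rewrite !ltry. Qed.

Lemma adde_neqNyP (a b : \bar R) : a + b != -oo -> a != -oo /\ b != -oo.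
Proof. by case: a b => [r| |] [s| |]. Qed.

Lemma adde_neqNy (a b : \bar R) : a != -oo -> b != -oo -> a + b != -oo.
Proof. by case: a b => [r| |] [s| |]. Qed.

Lemma muleDr_gtNy (k : R) (a b : \bar R) : a != -oo -> b != -oo ->
  k%:E * (a + b) = k%:E * a + k%:E * b.
Proof. by move=> aN bN; apply: muleDr => //; case: a b aN bN => [r| |] [s| |]. Qed.

Lemma adde_halfD (a b k : \bar R) :
  a + (2^-1)%:E * k + (b + (2^-1)%:E * k) = a + b + k.
Proof.
rewrite addeACA; congr (_ + _); case: k => [r| |].
- by rewrite -!EFinM -EFinD; congr EFin; lra.
- by rewrite gt0_muley ?lte_fin ?invr_gt0.
- by rewrite gt0_muleNy ?lte_fin ?invr_gt0.
Qed.

Lemma mule_neqNy (k : R) (a : \bar R) : (0 < k)%R -> (k%:E * a != -oo) = (a != -oo).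
Proof.
by move=> k0; case: a => [r| |]//; rewrite ?gt0_muley ?gt0_muleNy ?lte_fin.
Qed.

Lemma mule_lty (k : R) (a : \bar R) : (0 < k)%R -> (k%:E * a < +oo) = (a < +oo).
Proof.
by move=> k0; case: a => [r| |]//; rewrite ?gt0_muley ?gt0_muleNy ?lte_fin// -EFinM !ltry.
Qed.

Context d (T : measurableType d).
Implicit Types (pi : probability T R) (mu : {finite_measure set T -> \bar R}).

Lemma KL_lty_density pi mu : KL pi mu < +oo -> exists f, has_density pi mu f.
Proof.
by rewrite /KL; case: asboolP => [pimu _|//]; exact: dominates_density.
Qed.

(** The integral of ln f under the law of density f has an integrable negative
part, so the entropy cannot take the value -oo. *)
Lemma KL_gtNy pi mu : KL pi mu != -oo.
Proof.
have [y|y] := ltP (KL pi mu) +oo; last by rewrite gt_eqF// (lt_le_trans _ y).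
have [f df] := KL_lty_density y; rewrite (KL_density df).
exact: quasi_integrable_gtNy (quasi_integrable_ln_density df).
Qed.

End finiteness.

Section transport.
Context dX dZ (X : measurableType dX) (Z : measurableType dZ) (R : realType).
Variables (psi : X -> Z -> \bar R) (lam : {finite_measure set Z -> \bar R}) (eps : R).
Hypotheses (psi_gtNy : forall x z, psi x z != -oo)
  (mpsi : measurable_fun setT (fun p : X * Z => psi p.1 p.2))
  (eps_gt0 : (0 < eps)%R)
  (int_fin : forall x, \int[lam]_z expeR (- ((2 / eps)%:E * psi x z)) < +oo).

Local Notation K := (gibbs_kernel psi eps).
Local Notation k := (soft_kernel psi lam eps).
Local Notation c := (soft_cost psi eps lam).

Let mK := measurable_gibbs_kernel psi_gtNy mpsi eps_gt0.
Let K0 := gibbs_kernel_ge0 psi eps.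
Let kE := soft_kernelE psi_gtNy mpsi eps_gt0 int_fin.

(** The part of the objective shared by the balanced and unbalanced problems. *)
Definition plan_cost d1 d2 (A : measurableType d1) (B : measurableType d2)
    (b : A -> B -> \bar R) (mu : {finite_measure set A -> \bar R})
    (nu : {finite_measure set B -> \bar R}) (pi : probability (A * B)%type R) :=
  \int[pi]_p b p.1 p.2 + eps%:E * KL pi (tensor mu nu).

Section plan_cost_finite.
Variables (mu nu : {finite_measure set X -> \bar R}) (pi : probability (X * X)%type R).
Hypothesis wpi : integral_well_defined c pi.

(** A finite cost forces pi to have a density, and k to be positive pi-almost
everywhere. *)
Lemma plan_cost_finite : plan_cost c mu nu pi < +oo ->
  exists q, [/\ has_density pi (tensor mu nu) q, {ae pi, forall v, (0 < k v)%R},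
    quasi_integrable pi (fun v => (ln (q v) - ln (k v))%:E) &
    plan_cost c mu nu pi = eps%:E * \int[pi]_v (ln (q v) - ln (k v))%:E].
Proof.
move=> /adde_ltyP[]; last first.
- move=> cy; rewrite mule_lty// => /KL_lty_density[q qpi]; exists q.
  have kpi := soft_kernel_ae_gt0 psi_gtNy mpsi eps_gt0 int_fin wpi cy.
  by have [] := soft_cost_value psi_gtNy mpsi eps_gt0 int_fin qpi wpi kpi.
- by rewrite mule_neqNy// KL_gtNy.
- exact: quasi_integrable_gtNy
    (quasi_integrable_soft_cost psi_gtNy mpsi eps_gt0 int_fin wpi).
Qed.

End plan_cost_finite.

(** Split pi into p1 and p2, then glue p1 to itself and p2 to itself. The sum of
the two costs is at most 2 eps (u1 + u2), which is at most twice the cost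
of pi. *)
Lemma debiased_plans (mu nu : {finite_measure set X -> \bar R})
    (pi : probability (X * X)%type R) :
  integral_well_defined c pi ->
  (forall D : probability (X * X)%type R,
    (forall A, measurable A -> marginal1 D A = marginal1 pi A) ->
    (forall A, measurable A -> marginal2 D A = marginal1 pi A) ->
    integral_well_defined c D) ->
  (forall D : probability (X * X)%type R,
    (forall A, measurable A -> marginal1 D A = marginal2 pi A) ->
    (forall A, measurable A -> marginal2 D A = marginal2 pi A) ->
    integral_well_defined c D) ->
  plan_cost c mu nu pi < +oo ->
  exists pi1 pi2 : probability (X * X)%type R,
  [/\ forall A, measurable A ->
        marginal1 pi1 A = marginal1 pi A /\ marginal2 pi1 A = marginal1 pi A,
      forall A, measurable A ->
        marginal1 pi2 A = marginal2 pi A /\ marginal2 pi2 A = marginal2 pi A &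
      plan_cost c mu mu pi1 + plan_cost c nu nu pi2 <=
        2%:E * plan_cost c mu nu pi].
Proof.
move=> wpi w1 w2 Vy; have [q [qpi kpi qL VE]] := plan_cost_finite wpi Vy.
have [eta [g [p1 [f1 [p2 [f2 [geta hp1 hp2 [m1 m2] H]]]]]]] :=
  plan_splitting mK mK K0 K0 kE qpi kpi.
have q1 : quasi_integrable p1 (fun v => (half_cost K g f1 v)%:E).
  apply: (quasi_integrable_half_cost psi_gtNy mpsi eps_gt0 int_fin geta hp1).
  move=> D D1 D2; apply: w1 => A mA; [rewrite /marginal1|rewrite /marginal2].
    by apply: (etrans (D1 A mA)); exact: m1.
  by apply: (etrans (D2 A mA)); exact: m1.
have q2 : quasi_integrable p2 (fun v => (half_cost K g f2 v)%:E).
  apply: (quasi_integrable_half_cost psi_gtNy mpsi eps_gt0 int_fin geta hp2).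
  move=> D D1 D2; apply: w2 => A mA; [rewrite /marginal1|rewrite /marginal2].
    by apply: (etrans (D1 A mA)); exact: m2.
  by apply: (etrans (D2 A mA)); exact: m2.
have [pi1 [r1 [dr1 k1 [a1 b1] H1]]] := plan_gluing mK mK K0 K0 kE geta hp1 hp1.
have [pi2 [r2 [dr2 k2 [a2 b2] H2]]] := plan_gluing mK mK K0 K0 kE geta hp2 hp2.
have e1 A : measurable A -> marginal1 pi1 A = marginal1 pi A /\
    marginal2 pi1 A = marginal1 pi A.
  move=> mA; split; first exact: (etrans (a1 A mA) (m1 A mA)).
  exact: (etrans (b1 A mA) (m1 A mA)).
have e2 A : measurable A -> marginal1 pi2 A = marginal2 pi A /\
    marginal2 pi2 A = marginal2 pi A.
  move=> mA; split; first exact: (etrans (a2 A mA) (m2 A mA)).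
  exact: (etrans (b2 A mA) (m2 A mA)).
exists pi1, pi2; split => //.
have wd1 : integral_well_defined c pi1 by apply: w1 => A /e1[].
have wd2 : integral_well_defined c pi2 by apply: w2 => A /e2[].
have [ql1 V1] := soft_cost_value psi_gtNy mpsi eps_gt0 int_fin dr1 wd1 k1.
have [ql2 V2] := soft_cost_value psi_gtNy mpsi eps_gt0 int_fin dr2 wd2 k2.
move: Vy; rewrite VE /plan_cost V1 V2 mule_lty//.
move: (H q1 q2) (H1 q1 q1 ql1) (H2 q2 q2 ql2).
move: (quasi_integrable_gtNy q1) (quasi_integrable_gtNy q2).
move: (quasi_integrable_gtNy ql1) (quasi_integrable_gtNy ql2).
set U1 := \int[p1]_v _; set U2 := \int[p2]_v _; set L := \int[pi]_v _.
set L1 := \int[pi1]_v _; set L2 := \int[pi2]_v _.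
case: U1 U2 L L1 L2 => [u1| |] [u2| |] [l| |] [l1| |] [l2| |]//= _ _ _ _ h h1 h2 _.
move: h h1 h2; rewrite -?EFinD -?EFinM !lee_fin => h h1 h2.
by rewrite -mulrDr mulrCA ler_pM2l//; lra.
Qed.

Lemma swapped_plan (mu nu : {finite_measure set X -> \bar R})
    (pi : probability (X * X)%type R) : integral_well_defined c pi ->
  plan_cost c mu nu pi < +oo ->
  exists pi' : probability (X * X)%type R,
  [/\ forall A, marginal1 pi' A = marginal2 pi A,
      forall A, marginal2 pi' A = marginal1 pi A &
      plan_cost c nu mu pi' = plan_cost c mu nu pi].
Proof.
move=> wpi Vy; have [q [qpi _ _ _]] := plan_cost_finite wpi Vy.
have [pi' [pi'E KLE]] := density_swap qpi.
exists pi'; split; [by move=> A; exact: pi'E|by move=> A; exact: pi'E|].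
rewrite /plan_cost KLE; congr (_ + _).
have ms : measurable_fun setT (fun v : X * X => (v.2, v.1)).
  by apply: measurable_fun_pair; [exact: measurable_snd|exact: measurable_fst].
have pi'E' A : measurable A -> pi' A = pi ((fun v => (v.2, v.1)) @^-1` A).
  by move=> _; exact: pi'E.
rewrite (integral_image ms pi'E').
  by apply: eq_integral => v _; exact: soft_costC.
exact: measurable_soft_cost psi_gtNy mpsi eps_gt0 int_fin.
Qed.

End transport.

(** * Debiasedness of balanced and unbalanced transport *)

Section optimal_transport.
Context dX dZ (X : measurableType dX) (Z : measurableType dZ) (R : realType).
Variables (psi : X -> Z -> \bar R) (lam : {finite_measure set Z -> \bar R}) (eps : R).
Hypotheses (psi_gtNy : forall x z, psi x z != -oo)
  (mpsi : measurable_fun setT (fun p : X * Z => psi p.1 p.2))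
  (eps_gt0 : (0 < eps)%R)
  (int_fin : forall x, \int[lam]_z expeR (- ((2 / eps)%:E * psi x z)) < +oo).

Local Notation K := (gibbs_kernel psi eps).
Local Notation k := (soft_kernel psi lam eps).
Local Notation c := (soft_cost psi eps lam).

Let mK := measurable_gibbs_kernel psi_gtNy mpsi eps_gt0.
Let K0 := gibbs_kernel_ge0 psi eps.
Let kE := soft_kernelE psi_gtNy mpsi eps_gt0 int_fin.

Section balanced.
Hypothesis wd : forall mu nu : probability X R, OT_well_defined eps c mu nu.

Let OT_le_swap (mu nu : probability X R) : OT eps c mu nu <= OT eps c nu mu.
Proof.
apply: le_ereal_inf_tmp => _ [pi pinm <-]; have [pi1 pi2] := pinm.
have wpi : integral_well_defined c pi by have [w _] := wd nu mu; exact: w.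
rewrite -/(plan_cost eps c nu mu pi).
have [Vy|] := ltP (plan_cost eps c nu mu pi) +oo; last first.
  by rewrite leye_eq => /eqP ->; exact: leey.
have [pi' [e1 e2 <-]] := swapped_plan psi_gtNy mpsi eps_gt0 int_fin wpi Vy.
apply: ereal_inf_lbound; exists pi' => //; split => A mA.
  by rewrite e1; exact: pi2.
by rewrite e2; exact: pi1.
Qed.

Lemma OT_debiasable : debiasable (fun mu nu : probability X R => OT eps c mu nu).
Proof.
split=> [mu nu|mu nu|mu nu]; first by have [] := wd mu nu.
  by apply: le_anti; apply/andP; split; exact: OT_le_swap.
apply: debiased_inf; [by have [] := wd mu mu|by have [] := wd nu nu|
  by have [] := wd mu nu|].
move=> _ [pi pimn <-]; have [pi1 pi2] := pimn; rewrite -/(plan_cost eps c mu nu pi) => Vy.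
have wpi : integral_well_defined c pi by have [w _] := wd mu nu; exact: w.
have w1 D : (forall A, measurable A -> marginal1 D A = marginal1 pi A) ->
    (forall A, measurable A -> marginal2 D A = marginal1 pi A) ->
    integral_well_defined c D.
  move=> D1 D2; have [w _] := wd mu mu; apply: w; split => A mA.
    by rewrite D1//; exact: pi1.
  by rewrite D2//; exact: pi1.
have w2 D : (forall A, measurable A -> marginal1 D A = marginal2 pi A) ->
    (forall A, measurable A -> marginal2 D A = marginal2 pi A) ->
    integral_well_defined c D.
  move=> D1 D2; have [w _] := wd nu nu; apply: w; split => A mA.
    by rewrite D1//; exact: pi2.
  by rewrite D2//; exact: pi2.
have [p1 [p2 [e1 e2 V]]] :=
  debiased_plans psi_gtNy mpsi eps_gt0 int_fin wpi w1 w2 Vy.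
apply: (le_trans _ V); apply: leeD; apply: ereal_inf_lbound.
- exists p1 => //; split => A mA; have [h1 h2] := e1 A mA.
    by rewrite h1; exact: pi1.
  by rewrite h2; exact: pi1.
- exists p2 => //; split => A mA; have [h1 h2] := e2 A mA.
    by rewrite h1; exact: pi2.
  by rewrite h2; exact: pi2.
Qed.

End balanced.

Section unbalanced.
Variable h : R -> \bar R.
Hypothesis hE : csiszar_entropy h.
Hypothesis wd : forall mu nu : {finite_measure set X -> \bar R},
  UOT_well_defined eps c (csiszar h) mu nu.

Let V (mu nu : {finite_measure set X -> \bar R}) (pi : probability (X * X)%type R) :=
  \int[pi]_p c p.1 p.2 + csiszar h (marginal1 pi) mu +
  csiszar h (marginal2 pi) nu + eps%:E * KL pi (tensor mu nu).

Let VE mu nu pi : V mu nu pi = plan_cost eps c mu nu pi +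
  (csiszar h (marginal1 pi) mu + csiszar h (marginal2 pi) nu).
Proof. by rewrite /V -(addeA (\int[pi]_p _)) addeAC. Qed.

Let V_gtNy mu nu pi : V mu nu pi != -oo.
Proof.
have [_ Ny] := wd mu nu; rewrite -ltNye; apply: (@lt_le_trans _ _ (UOT eps c (csiszar h) mu nu)).
  by rewrite ltNye.
by apply: ereal_inf_lbound; exists pi.
Qed.

Let V_finite mu nu pi : V mu nu pi < +oo ->
  [/\ plan_cost eps c mu nu pi < +oo, csiszar h (marginal1 pi) mu \is a fin_num &
      csiszar h (marginal2 pi) nu \is a fin_num].
Proof.
have := V_gtNy mu nu pi; rewrite VE => /adde_neqNyP[PN FN].
have [F1N F2N] := adde_neqNyP FN.
move=> /(adde_ltyP PN FN)[Py /(adde_ltyP F1N F2N)[F1y F2y]].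
by split => //; rewrite fin_numE ?F1N ?F2N lt_eqF.
Qed.

Let UOT_le_swap mu nu : UOT eps c (csiszar h) mu nu <= UOT eps c (csiszar h) nu mu.
Proof.
apply: le_ereal_inf_tmp => _ [pi _ <-]; rewrite -/(V nu mu pi).
have [Vy|] := ltP (V nu mu pi) +oo; last first.
  by rewrite leye_eq => /eqP ->; exact: leey.
have wpi : integral_well_defined c pi by have [w _] := wd nu mu; exact: w.
have [Py _ _] := V_finite Vy.
have [pi' [e1 e2 PE]] := swapped_plan psi_gtNy mpsi eps_gt0 int_fin wpi Py.
apply: (@le_trans _ _ (V mu nu pi')); first by apply: ereal_inf_lbound; exists pi'.
rewrite !VE PE [X in _ + X <= _]addeC.
rewrite (csiszar_eq mu hE (fun A _ => e1 A)).
by rewrite (csiszar_eq nu hE (fun A _ => e2 A)).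
Qed.

Lemma UOT_debiasable : debiasable (fun mu nu : {finite_measure set X -> \bar R} =>
  UOT eps c (csiszar h) mu nu).
Proof.
split=> [mu nu|mu nu|mu nu]; first by have [] := wd mu nu.
  by apply: le_anti; apply/andP; split; exact: UOT_le_swap.
apply: debiased_inf; [by have [] := wd mu mu|by have [] := wd nu nu|
  by have [] := wd mu nu|].
move=> _ [pi _ <-]; rewrite -/(V mu nu pi) => Vy.
have [Py F1 F2] := V_finite Vy.
have w D : integral_well_defined c D by have [w _] := wd mu nu; exact: w.
have [p1 [p2 [e1 e2 P]]] := debiased_plans psi_gtNy mpsi eps_gt0 int_fin (w pi)
  (fun D _ _ => w D) (fun D _ _ => w D) Py.
apply: (@le_trans _ _ (V mu mu p1 + V nu nu p2)).
  by apply: leeD; apply: ereal_inf_lbound; [exists p1|exists p2].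
rewrite !VE.
rewrite (csiszar_eq mu hE (fun A mA => (e1 A mA).1)).
rewrite (csiszar_eq mu hE (fun A mA => (e1 A mA).2)).
rewrite (csiszar_eq nu hE (fun A mA => (e2 A mA).1)).
rewrite (csiszar_eq nu hE (fun A mA => (e2 A mA).2)).
have F12 : csiszar h (marginal1 pi) mu + csiszar h (marginal2 pi) nu \is a fin_num.
  by rewrite fin_numD F1.
rewrite addeACA muleDr//; last exact: fin_num_adde_defl.
apply: leeD => //; rewrite -(fineK F1) -(fineK F2) -!EFinD -EFinM lee_fin.
lra.
Qed.

End unbalanced.

End optimal_transport.

(** * The representation as an infimum over measures on Z *)

Section representation.
Context dX dZ (X : measurableType dX) (Z : measurableType dZ) (R : realType).
Variables (psi : X -> Z -> \bar R) (lam : {finite_measure set Z -> \bar R}) (eps : R).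
Hypotheses (psi_gtNy : forall x z, psi x z != -oo)
  (mpsi : measurable_fun setT (fun p : X * Z => psi p.1 p.2))
  (eps_gt0 : (0 < eps)%R)
  (int_fin : forall x, \int[lam]_z expeR (- ((2 / eps)%:E * psi x z)) < +oo).

Local Notation K := (gibbs_kernel psi eps).
Local Notation k := (soft_kernel psi lam eps).
Local Notation c := (soft_cost psi eps lam).

Let mK := measurable_gibbs_kernel psi_gtNy mpsi eps_gt0.
Let K0 := gibbs_kernel_ge0 psi eps.
Let kE := soft_kernelE psi_gtNy mpsi eps_gt0 int_fin.


(** Where the plan cost is finite psi is finite almost everywhere, that is K is
positive. *)
Lemma plan_cost_half_plan (mu : {finite_measure set X -> \bar R})
    (eta : probability Z R) (p : probability (X * Z)%type R) :
  (forall B, measurable B -> p (snd @^-1` B) = eta B) ->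
  integral_well_defined psi p -> plan_cost eps psi mu eta p < +oo ->
  exists f, half_plan mu eta K p f.
Proof.
move=> e2 wp; rewrite /plan_cost => /adde_ltyP[].
- by apply: (@quasi_integrable_gtNy _ _ _ p (fun v => psi v.1 v.2)).
- by rewrite mule_neqNy// KL_gtNy.
move=> psiy; rewrite mule_lty// => /KL_lty_density[f df].
exists f; split => //.
suff : {ae p, forall v : X * Z, psi v.1 v.2 < +oo}.
  apply: filterS => v psiv; rewrite -lte_fin (gibbs_kernelE psi_gtNy eps_gt0).
  have := psi_gtNy v.1 v.2; case: (psi v.1 v.2) psiv => [r| |]//= _ _.
  by rewrite lte_fin expR_gt0.
exact: (@quasi_integrable_ae_lty _ _ _ p (fun v => psi v.1 v.2)).
Qed.

Let plan_cost_gtNy (mu : {finite_measure set X -> \bar R}) (eta : probability Z R)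
    (p : probability (X * Z)%type R) :
  integral_well_defined psi p -> plan_cost eps psi mu eta p != -oo.
Proof.
move=> wp; apply: adde_neqNy; last by rewrite mule_neqNy// KL_gtNy.
by apply: (@quasi_integrable_gtNy _ _ _ p (fun v => psi v.1 v.2)).
Qed.

(** The inequality <= glues arbitrary couplings of (mu, eta) and (nu, eta); the
inequality >= splits an arbitrary coupling of (mu, nu). *)
Theorem OT_soft_cost_representation (mu nu : probability X R) :
  OT_well_defined eps c mu nu ->
  (forall eta : probability Z R,
    OT_well_defined eps psi mu eta /\ OT_well_defined eps psi nu eta) ->
  OT eps c mu nu =
  ereal_inf [set OT eps psi mu eta + OT eps psi nu eta + eps%:E * KL eta lam
            | eta in [set: probability Z R]].
Proof.
move=> [wc _] wpsi; apply/eqP; rewrite eq_le; apply/andP; split.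
- apply: le_ereal_inf_tmp => _ [eta _ <-].
  have [[w1 N1] [w2 N2]] := wpsi eta.
  have KN : eps%:E * KL eta lam != -oo by rewrite mule_neqNy// KL_gtNy.
  have [Ky|] := ltP (KL eta lam) +oo; last first.
    rewrite leye_eq => /eqP ->; rewrite gt0_muley ?lte_fin//.
    by rewrite addey ?leey// adde_neqNy.
  have [g geta] := KL_lty_density Ky.
  pose S1 := [set plan_cost eps psi mu eta p | p in couplings mu eta].
  pose S2 := [set plan_cost eps psi nu eta p | p in couplings nu eta].
  rewrite -[OT eps psi mu eta]/(ereal_inf S1) -[OT eps psi nu eta]/(ereal_inf S2).
  apply: le_inf_add; [exact: N1|exact: N2|exact: KN|].
  move=> _ _ [p1 c1 <-] [p2 c2 <-].
  have wp1 := w1 _ c1; have wp2 := w2 _ c2.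
  have VN1 := plan_cost_gtNy mu eta wp1; have VN2 := plan_cost_gtNy nu eta wp2.
  have [V1|] := ltP (plan_cost eps psi mu eta p1) +oo; last first.
    by rewrite leye_eq => /eqP ->; rewrite addye// addye// leey.
  have [V2|] := ltP (plan_cost eps psi nu eta p2) +oo; last first.
    by rewrite leye_eq => /eqP ->; rewrite addey// addye// leey.
  have [f1 hp1] := plan_cost_half_plan (c1.2) wp1 V1.
  have [f2 hp2] := plan_cost_half_plan (c2.2) wp2 V2.
  have [pi [q [qpi kpi [a1 a2] H]]] := plan_gluing mK mK K0 K0 kE geta hp1 hp2.
  have cpi : couplings mu nu pi.
    split => A mA; first exact: (etrans (a1 A mA) (c1.1 A mA)).
    exact: (etrans (a2 A mA) (c2.1 A mA)).
  have [qL VL] := soft_cost_value psi_gtNy mpsi eps_gt0 int_fin qpi (wc _ cpi) kpi.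
  have [q1 E1] := half_cost_value psi_gtNy mpsi eps_gt0 geta hp1 wp1.
  have [q2 E2] := half_cost_value psi_gtNy mpsi eps_gt0 geta hp2 wp2.
  apply: (@le_trans _ _ (plan_cost eps c mu nu pi)).
    by apply: ereal_inf_lbound; exists pi.
  rewrite [leLHS]VL -adde_halfD -E1 -E2 -muleDr_gtNy; last 2 first.
  - exact: quasi_integrable_gtNy q1.
  - exact: quasi_integrable_gtNy q2.
  by apply: lee_wpmul2l; [rewrite lee_fin ltW|exact: H].
- apply: le_ereal_inf_tmp => _ [pi cpi <-].
  rewrite -/(plan_cost eps c mu nu pi).
  have [Vy|] := ltP (plan_cost eps c mu nu pi) +oo; last first.
    by rewrite leye_eq => /eqP ->; exact: leey.
  have [q [qpi kpi qL VE]] :=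
    plan_cost_finite psi_gtNy mpsi eps_gt0 int_fin (wc _ cpi) Vy.
  have [eta [g [p1 [f1 [p2 [f2 [geta hp1 hp2 [m1 m2] H]]]]]]] :=
    plan_splitting mK mK K0 K0 kE qpi kpi.
  have c1 : couplings mu eta p1.
    split=> A mA; first exact: (etrans (m1 A mA) (cpi.1 A mA)).
    by have [_ e _] := hp1; exact: e.
  have c2 : couplings nu eta p2.
    split=> A mA; first exact: (etrans (m2 A mA) (cpi.2 A mA)).
    by have [_ e _] := hp2; exact: e.
  have [[w1 _] [w2 _]] := wpsi eta.
  have [q1 E1] := half_cost_value psi_gtNy mpsi eps_gt0 geta hp1 (w1 _ c1).
  have [q2 E2] := half_cost_value psi_gtNy mpsi eps_gt0 geta hp2 (w2 _ c2).
  apply: (@le_trans _ _ (plan_cost eps psi mu eta p1 + plan_cost eps psi nu eta p2 +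
      eps%:E * KL eta lam)).
    apply: (@le_trans _ _ (OT eps psi mu eta + OT eps psi nu eta + eps%:E * KL eta lam)).
      by apply: ereal_inf_lbound; exists eta.
    by apply: leeD2r; apply: leeD; apply: ereal_inf_lbound; [exists p1|exists p2].
  rewrite VE -adde_halfD -E1 -E2 -muleDr_gtNy; last 2 first.
  - exact: quasi_integrable_gtNy q1.
  - exact: quasi_integrable_gtNy q2.
  by apply: lee_wpmul2l; [rewrite lee_fin ltW|exact: H].
Qed.

(** A pointwise bound K K <= exp (- b / eps) is preserved by averaging. *)
Lemma le_soft_cost (b : X -> X -> \bar R) : lam setT = 1 ->
  (forall x y z, b x y <= psi x z + psi y z) ->
  forall x y, b x y <= c x y.
Proof.
move=> lam1 bpsi x y; have e0 : (0 < eps^-1)%R by rewrite invr_gt0.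
have kb : (k (x, y))%:E <= expeR (- (eps^-1%:E * b x y)).
  rewrite -[leRHS]mule1 -lam1 -integral_cst// kE.
  apply: ge0_le_integral => //.
  - by move=> z _; rewrite lee_fin mulr_ge0.
  - apply/measurable_EFinP; apply: measurable_funM;
      exact: (measurableT_comp mK (pair1_measurable _)).
  - move=> z _; rewrite gibbs_kernelM// lee_expeR leeN2.
    by apply: lee_wpmul2l => //; rewrite lee_fin ltW.
rewrite (soft_costE psi_gtNy mpsi eps_gt0 int_fin) leeNr.
have : lne (k (x, y))%:E <= - (eps^-1%:E * b x y).
  rewrite -[leRHS]expeRK lee_lne// in_itv/= ?leey ?andbT ?expeR_ge0//.
  by rewrite lee_fin; exact: (soft_kernel_ge0 psi_gtNy mpsi eps_gt0 int_fin).
move=> /(lee_wpmul2l (_ : 0 <= eps%:E)) h.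
apply: le_trans (h _) _; first by rewrite lee_fin ltW.
by rewrite muleN muleA -EFinM mulfV ?gt_eqF// mul1e.
Qed.

Lemma le_OT (b b' : X -> X -> \bar R) (mu nu : probability X R) :
  (forall x y, b x y <= b' x y) -> OT eps b mu nu <= OT eps b' mu nu.
Proof.
move=> bb'; apply: le_ereal_inf_tmp => _ [pi cpi <-].
apply: (@le_trans _ _ (\int[pi]_p b p.1 p.2 + eps%:E * KL pi (tensor mu nu))).
  by apply: ereal_inf_lbound; exists pi.
by apply: leeD2r; apply: le_integral_pointwise => v.
Qed.

End representation.

Theorem theorem4p6 (R : realType) (X Z : ptopologicalType)
    (polX : polish_space R X) (polZ : polish_space R Z)
    (c : borel X -> borel X -> \bar R) (c_debiasable : debiasable c)
    (psi : borel X -> borel Z -> \bar R)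
    (psi_repr : inf_representation c psi)
    (psi_meas : measurable_fun [set: borel X * borel Z]
                  (fun p => psi p.1 p.2))
    (lambda : {finite_measure set (borel Z) -> \bar R})
    (eps : R) (eps_gt0 : (0 < eps)%R)
    (int_fin : forall x,
       \int[lambda]_z expeR (- ((2 / eps)%:E * psi x z)) < +oo) :
  let c_eps : borel X -> borel X -> \bar R := soft_cost psi eps lambda in
  [/\ (forall mu nu : probability (borel X) R,
          OT_well_defined eps c_eps mu nu) ->
        debiasable (fun mu nu : probability (borel X) R =>
          OT eps c_eps mu nu),
      forall h : R -> \bar R, csiszar_entropy h ->
        (forall mu nu : {finite_measure set (borel X) -> \bar R},
          UOT_well_defined eps c_eps (csiszar h) mu nu) ->
        debiasable (fun mu nu : {finite_measure set (borel X) -> \bar R} =>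
          UOT eps c_eps (csiszar h) mu nu),
      forall mu nu : probability (borel X) R,
        OT_well_defined eps c_eps mu nu ->
        (forall eta : probability (borel Z) R,
          OT_well_defined eps psi mu eta /\ OT_well_defined eps psi nu eta) ->
        OT eps c_eps mu nu =
        ereal_inf [set OT eps psi mu eta + OT eps psi nu eta +
                       eps%:E * KL eta lambda
                  | eta in [set: probability (borel Z) R]] &
      lambda setT = 1 ->
        forall mu nu : probability (borel X) R,
          OT eps c mu nu <= OT eps c_eps mu nu].
Proof.
move=> c_eps; have [psi_gtNy cE] := psi_repr; split.
- exact: (OT_debiasable psi_gtNy psi_meas eps_gt0 int_fin).
- move=> h hE wd; exact: (UOT_debiasable psi_gtNy psi_meas eps_gt0 int_fin hE wd).
- move=> mu nu wc wpsi.
  exact: (OT_soft_cost_representation psi_gtNy psi_meas eps_gt0 int_fin wc wpsi).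
- move=> lam1 mu nu; apply: le_OT.
  apply: (le_soft_cost psi_gtNy psi_meas eps_gt0 int_fin lam1) => x y z.
  by rewrite cE; apply: ereal_inf_lbound; exists z.
Qed.
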